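(* Let $0\le h<2$, let $n\ge 1$, and let $H=(h_{ij})_{n\times n}$ be an indecomposable $h$-Shuhan matrix. Write $H_\sigma=(h_{\sigma(i),\sigma(j)})_{n\times n}$ for $\sigma\in\mathbb S_n$. (1) $H$ is positive semi-definite if and only if for some $\sigma\in \mathbb S_n$ the matrix $H_\sigma$ is one of the following: (i) $A_n^h$ with $h\ge 2\cos\frac{\pi}{n+1}$, $n>0$; (ii) $D_n^h$ with $h\ge 2\cos\frac{\pi}{2(n-1)}$, $n>3$; (iii) $E_6^h$ with $h\ge 2\cos\frac{\pi}{12}$; (iv) $E_7^h$ with $h\ge 2\cos\frac{\pi}{18}$; (v) $E_8^h$ with $h\ge 2\cos\frac{\pi}{30}$. (2) $H$ is virtual positive semi-definite if and only if $H$ is positive semi-definite or for some $\sigma\in\mathbb S_n$ the matrix $H_\sigma$ is one of the following: (i) $B_n^h$ with $h\ge 2\cos\frac{\pi}{2n}$, $n>1$; (ii) $F_4^h$ with $h\ge 2\cos\frac{\pi}{12}$; (iii) $G_2^h$ with $h\ge 2\cos\frac{\pi}{6}$. (3) $H$ is generalized positive semi-definite if and only if $H$ is positive semi-definite or for some $\sigma\in\mathbb S_n$ one has $H_\sigma=B_n^h$ with $2\le n\le 8$ and $h\ge\mu_n$, where $$\mu_2=\tfrac32,\quad \mu_3=\tfrac{\sqrt{13}}2,\quad \mu_4=\sqrt{\tfrac{17}{8}+\tfrac{\sqrt{145}}{8}},\quad \mu_5=\sqrt{\tfrac{21}{8}+\tfrac{\sqrt{89}}{8}},\quad \mu_6=\sqrt{\tfrac{25}{12}+\tfrac{\sqrt{157}}{6}\cos\theta_1},$$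 $$\mu_7=\sqrt{\tfrac{29}{12}+\tfrac{11}{12}\cos\theta_2+\tfrac{11\sqrt3}{12}\sin\theta_2},\quad \mu_8=\sqrt{\tfrac{33}{16}+\tfrac{\beta}{16}+\tfrac12\sqrt{\tfrac{547}{96}-\tfrac{\alpha}{6}+\tfrac{17}{32\beta}}},$$ with $\theta_1=\frac13\arctan\frac{54\sqrt{1327}}{19}$, $\theta_2=\frac13\arctan\frac{12\sqrt{11919}}{235}$, $\alpha=\sqrt{727}\cos\!\big(\frac13\arctan\frac{3\sqrt{37701987}}{34607}\big)$, $\beta=\sqrt{\frac{547}{3}+\frac{32}{3}\alpha}$.
   Context: All matrices are real, and $'$ denotes transpose. A real $n\times n$ matrix $H$ is virtual positive semi-definite if all its principal minors (of every order $1,\dots,n$) are $\ge 0$. It is generalized positive semi-definite if $x'Hx\ge 0$ for all real column vectors $x$ of length $n$. Positive semi-definite means symmetric and generalized positive semi-definite. $\mathbb S_n$ is the symmetric group on $\{1,\dots,n\}$. For a real $h\ge 0$, a real $n\times n$ matrix $H=(h_{ij})$ is an $h$-Shuhan matrix if: (S1) $h_{ii}=h$ for all $i$; (S2) $h_{ij}$ is an integer $\le 0$ for $i\ne j$; (S3) for each pair $i\neq j$, either $h_{ij}=h_{ji}$, or (after possibly exchanging $i$ and $j$) $h_{ij}<h_{ji}=-1$. $H$ is indecomposable if no simultaneous permutation of rows and columns makes it block diagonal with at least two blocks. The matrices $A_n^h,B_n^h,D_n^h,E_j^h,F_4^h,G_2^h$ are the Cartan matrices of the corresponding types with the diagonal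 $2$'s replaced by $h$. Explicitly, all diagonal entries equal $h$ and all off-diagonal entries not listed are $0$: - $A_n^h$ ($n\ge1$): $(i,i+1)$ and $(i+1,i)$ entries $-1$ for $1\le i\le n-1$. - $B_n^h$ ($n\ge2$): as $A_n^h$ except that the $(n-1,n)$ entry is $-2$ (the $(n,n-1)$ entry is $-1$). - $D_n^h$ ($n\ge4$): symmetric, entries $-1$ at the pairs $\{i,i+1\}$, $1\le i\le n-2$, and $\{n-2,n\}$. - $E_j^h$ ($j=6,7,8$): $j\times j$ symmetric, entries $-1$ at the pairs $\{i,i+1\}$, $1\le i\le j-2$, and $\{3,j\}$. - $F_4^h$: as $A_4^h$ except that the $(2,3)$ entry is $-2$. - $G_2^h=\begin{pmatrix} h&-1\\-3&h\end{pmatrix}$.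
   Formalization: In (2)(i) and (3), ''H_σ = B_n^h'' is replaced by ''H_σ or its transpose equals B_n^h'': as written both parts fail for n ≥ 3, e.g. for the transpose of B_3^h with h = 19/10, which is h-Shuhan and virtual and generalized positive semi-definite but not a permutation of B_3^h. *)

(* Defs.v *)
From HB Require Import structures.
From mathcomp Require Import all_boot all_order all_algebra all_fingroup.
From mathcomp Require Import all_classical all_reals all_analysis.

Set Implicit Arguments.
Unset Strict Implicit.
Unset Printing Implicit Defensive.

Import Order.TTheory GRing.Theory Num.Theory.

Local Open Scope ring_scope.

Section Definitions.

Variables (R : realType) (n : nat).
Implicit Types (H : 'M[R]_n) (h : R) (s : 'S_n).

Definition mxconj_perm H s : 'M[R]_n := \matrix_(i, j) H (s i) (s j).

(* [enum_val] enumerates [A] in increasing order. *)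
Definition principal_minor H (A : {set 'I_n}) : R :=
  \det (mxsub (@enum_val _ (mem A)) (@enum_val _ (mem A)) H).

Definition virtual_psd H : Prop :=
  forall A : {set 'I_n}, A != finset.set0 -> 0 <= principal_minor H A.

Definition generalized_psd H : Prop :=
  forall x : 'cV[R]_n, 0 <= (x^T *m H *m x) 0 0.

Definition psd H : Prop := H^T = H /\ generalized_psd H.

Definition shuhan h H : Prop :=
  [/\ 0 <= h,
      forall i, H i i = h,
      forall i j, i != j -> H i j \is a Num.int /\ H i j <= 0
    & forall i j, i != j ->
        [\/ H i j = H j i,
            H i j < H j i /\ H j i = -1
          | H j i < H i j /\ H i j = -1]].

Definition indecomposable H : Prop :=
  ~ exists (s : 'S_n) (p q : nat) (e : (p.+1 + q.+1)%N = n)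
           (P : 'M[R]_p.+1) (Q : 'M[R]_q.+1),
      mxconj_perm H s = castmx (e, e) (block_mx P 0 0 Q).

(* The families below are defined for every size n, although only the sizes of
   the corresponding Cartan matrices are meaningful.  Indices in 'I_n start at
   0, so the vertex called k in the usual numbering is the index k - 1. *)

Definition edge (a b : nat) (i j : 'I_n) : bool :=
  ((i == a :> nat) && (j == b :> nat)) || ((i == b :> nat) && (j == a :> nat)).

Definition consecutive (i j : 'I_n) : bool :=
  (j == i.+1 :> nat) || (i == j.+1 :> nat).

Definition cartanA h : 'M[R]_n := \matrix_(i, j)
  if i == j then h else if consecutive i j then -1 else 0.

Definition cartanB h : 'M[R]_n := \matrix_(i, j)
  if (i.+2 == n) && (j.+1 == n) then -2 else cartanA h i j.

Definition cartanD h : 'M[R]_n := \matrix_(i, j)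
  if i == j then h
  else if [&& consecutive i j, i < n.-1 & j < n.-1]%N
          || edge (n - 3)%N (n - 1)%N i j then -1
  else 0.

Definition cartanE h : 'M[R]_n := \matrix_(i, j)
  if i == j then h
  else if [&& consecutive i j, i < n.-1 & j < n.-1]%N
          || edge 2 (n - 1)%N i j then -1
  else 0.

Definition cartanF h : 'M[R]_n := \matrix_(i, j)
  if (i == 1%N :> nat) && (j == 2%N :> nat) then -2 else cartanA h i j.

Definition cartanG h : 'M[R]_n := \matrix_(i, j)
  if i == j then h else if i == 0%N :> nat then -1 else -3.

(* C_n^h is the transpose of B_n^h.  For n > 2 it is not a simultaneous
   permutation of B_n^h, yet it is an h-Shuhan matrix with the same principal
   minors and the same quadratic form; the classifications that involve B_n^h
   therefore hold only up to transposition. *)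
Definition is_B_up_to_transpose h H : Prop := H = cartanB h \/ H^T = cartanB h.

End Definitions.

Section Bounds.

Variable R : realType.

Definition theta1 : R := 3^-1 * atan (54 * Num.sqrt 1327 / 19).

Definition theta2 : R := 3^-1 * atan (12 * Num.sqrt 11919 / 235).

(* 37701987 and 34607 are written in base 1000 because numerals of type R go
   through unary naturals. *)
Definition alpha8 : R :=
  Num.sqrt 727 *
  cos (3^-1 * atan (3 * Num.sqrt ((37 * 1000 + 701) * 1000 + 987)
                    / (34 * 1000 + 607))).

Definition beta8 : R := Num.sqrt (547 / 3 + 32 / 3 * alpha8).

(* Only the values at 2 <= n <= 8 are meaningful. *)
Definition mu_bound (n : nat) : R :=
  match n with
  | 2 => 3 / 2
  | 3 => Num.sqrt 13 / 2
  | 4 => Num.sqrt (17 / 8 + Num.sqrt 145 / 8)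
  | 5 => Num.sqrt (21 / 8 + Num.sqrt 89 / 8)
  | 6 => Num.sqrt (25 / 12 + Num.sqrt 157 / 6 * cos theta1)
  | 7 => Num.sqrt (29 / 12 + 11 / 12 * cos theta2
                   + 11 * Num.sqrt 3 / 12 * sin theta2)
  | 8 => Num.sqrt (33 / 16 + beta8 / 16
                   + 2^-1 * Num.sqrt (547 / 96 - alpha8 / 6 + 17 / (32 * beta8)))
  | _ => 0
  end.

End Bounds.

Arguments mu_bound {R} n.

(* Main.v *)
(* Write no_neg M if no nonzero x >= 0 has (M x)_i < 0 at every i with x_i > 0.
   Each of the three positivity notions implies no_neg: for a quadratic form
   because x' M x = sum_i x_i (M x)_i, for nonnegative principal minors by the
   Fiedler-Ptak argument.

   For an h-Shuhan matrix with h < 2, no_neg forbids every nonnegative integer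
   weighting x of the vertices with 2 x_i <= sum_j a_ij x_j on its support, where
   a_ij = - h_ij, that is, every affine diagram.  A longest path of the Dynkin
   diagram and the few vertices outside it then leave only the types A-G.

   For each type let y > 0 be the Perron vector, C y = (h - l) y.  If h < l then
   y contradicts no_neg; if h >= l then C y >= 0 makes all principal minors
   nonnegative and, for symmetric C, the quadratic form as well.  So all the
   bounds are Perron eigenvalues l: 2 cos (pi / Coxeter number) for the Cartan
   matrix itself, and mu_n for the symmetrization of B_n, a path whose last edge
   has weight 3 / 2; for F_4, G_2 and B_n with n >= 9 that eigenvalue is at
   least 2. *)

From mathcomp Require Import all_boot zify.

Set Implicit Arguments.
Unset Strict Implicit.
Unset Printing Implicit Defensive.

(** * Exclusion of affine diagrams and classification *)

(** Virtual positivity provides no quadratic form and the matrices need not be symmetric, so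
    root-system arguments on a symmetrized form are not directly available. The test [no_neg] looks
    at rows only, and [h < 2] makes the weak inequality of an affine weighting strict. Multiple
    edges of either orientation are treated at once by giving a neighbour [j] of [i] a weight
    proportional to [a j i]: row [i] then collects the symmetric product [a i j * a j i], while row
    [j] is balanced by this edge alone.

    No Perron-Frobenius theorem is used: a positive vector is exhibited for each type. This is why,
    from n = 4 on, the closed form of mu_n is accompanied by a lower bound: the characteristic
    equation does not single out its largest root, positivity of the vector does. Equal bounds for
    different types come from folding, which keeps the Perron vector: B_n from D_(n+1), F_4 from
    E_6, G_2 from D_4. *)

Lemma tent_superharmonic m i L k : m <= i.+1 -> i + m <= L -> k < L ->
  let f k := m - ((k - i) + (i - k)) in 0 < f k ->
  2 * f k <= (if k is k'.+1 then f k' else 0) + (if k.+1 < L then f k.+1 else 0) +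
    (if k == i then 2 else 0).
Proof. by move=> mi iL; case: k => [|k] kL /= fk; case: ifP; case: eqP; lia. Qed.

(** Along the path the weights are 2, 4, 6, 5, 4, 3, 2, 1, those of affine E_8; the summand 3 is the
    weight of the vertex attached at position 2. Beyond position 7 truncated subtraction gives 0. *)
Lemma E8_superharmonic L k : 7 < L -> k < L ->
  let f k := if k <= 2 then 2 * k.+1 else 8 - k in 0 < f k ->
  2 * f k <= (if k is k'.+1 then f k' else 0) + (if k.+1 < L then f k.+1 else 0) +
    (if k == 2 then 3 else 0).
Proof.
case: k => [|[|[|k]]] L8 kL /=; try by case: ifP => //; lia.
by case: ifP; case: ifP; lia.
Qed.

Definition consec i j := (j == i.+1) || (i == j.+1).

Definition shapeB n i j :=
  if (i.+2 == n) && (j.+1 == n) then 2 else consec i j : nat.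

(** D_n and E_n share this shape: a path on the first n - 1 indices, with index n - 1 attached at b,
    where b is n - 3 or 2. *)
Definition shapeDE b n i j := [&& consec i j, i < n.-1 & j < n.-1] ||
  (((i == b) && (j == n.-1)) || ((i == n.-1) && (j == b))).

Definition shapeF i j := if (i == 1) && (j == 2) then 2 else consec i j : nat.

Definition shapeG i j := if i == j then 0 else if i == 0 then 1 else 3.

Definition agree n (b s : nat -> nat -> nat) :=
  forall i j, i < n -> j < n -> b i j = s i j.

(** The transpose of B_n has its own case because reversing the path moves the double edge to the
    other end, whereas reversal exchanges the two orientations of F_4 and of G_2. *)
Inductive finite_type n b : Prop :=
| TypeA of agree n b consec
| TypeB of 1 < n & agree n b (shapeB n)
| TypeC of 1 < n & agree n b (fun i j => shapeB n j i)
| TypeD of 3 < n & agree n b (shapeDE (n - 3) n)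
| TypeE of 5 < n & n <= 8 & agree n b (shapeDE 2 n)
| TypeF of n = 4 & agree n b shapeF
| TypeG of n = 2 & agree n b shapeG.

(** * Excluded configurations: stars, cycles, paths with two heavy ends *)

Section Diagram.
Variables (T : finType) (a : T -> T -> nat).
Hypothesis a_diag : forall i, a i i = 0.
Hypothesis a_pair : forall i j,
  [\/ a i j = a j i, 1 < a i j /\ a j i = 1 | 1 < a j i /\ a i j = 1].
Hypothesis a_excl : forall x : T -> nat,
  (forall i, 0 < x i -> 2 * x i <= \sum_j a i j * x j) -> forall i, x i = 0.
Hypothesis a_conn : forall (S : {set T}) (w u : T), w \in S -> u \notin S ->
  exists w' u', [/\ w' \in S, u' \notin S & 0 < a w' u'].

(* [size] occurs both at [Finite.sort T] and at [Equality.sort T], which lia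
   treats as different atoms. *)
Ltac size_lia := try change (@size (Equality.sort T)) with (@size T) in *; lia.

Definition adj i j := 0 < a i j.

Lemma adj_sym : symmetric adj.
Proof. by move=> i j; rewrite /adj; case: (a_pair i j); lia. Qed.

Lemma adj_mul i j : adj i j -> 0 < a i j * a j i.
Proof. by move=> eij; rewrite muln_gt0 (eij : 0 < _) /=;
  rewrite adj_sym in eij. Qed.

Lemma leq_sum_seq (F : T -> nat) (s : seq T) (P : pred T) :
  uniq s -> all P s -> \sum_(j <- s) F j <= \sum_(j | P j) F j.
Proof.
move=> us /allP sP; rewrite big_uniq //= big_mkcond [X in _ <= X]big_mkcond /=.
by apply: leq_sum => i _; case: ifP => // /sP ->.
Qed.

Lemma leq_sum1 (F : T -> nat) (P : pred T) x : P x -> F x <= \sum_(j | P j) F j.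
Proof.
by move=> Px; have := @leq_sum_seq F [:: x] P; rewrite big_seq1 /= Px => ->.
Qed.

Lemma leq_sum2 (F : T -> nat) (P : pred T) x y : x != y -> P x -> P y ->
  F x + F y <= \sum_(j | P j) F j.
Proof.
move=> xy Px Py; have := @leq_sum_seq F [:: x; y] P.
by rewrite !big_cons big_nil addn0 /= Px Py inE xy; apply.
Qed.

Lemma leq_sum3 (F : T -> nat) (P : pred T) x y z : x != y -> x != z -> y != z ->
  P x -> P y -> P z -> F x + F y + F z <= \sum_(j | P j) F j.
Proof.
move=> xy xz yz Px Py Pz; have := @leq_sum_seq F [:: x; y; z] P.
by rewrite !big_cons big_nil addn0 addnA /= Px Py Pz !inE !negb_or xy xz yz; apply.
Qed.

(** Weight 2 at [i] and [a j i] at each neighbour [j] satisfies every row [j] and turns row [i] into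
    the sum of the products, so a sum of at least 4 is excluded. This one weighting covers affine
    D_4 and its degenerations with multiple edges. *)
Lemma star i : \sum_j a i j * a j i <= 3.
Proof.
rewrite leqNgt; apply/negP => ge4.
have := a_excl (x := fun j => if j == i then 2 else a j i).
move/(_ _ i); rewrite eqxx => H; have : 2 = 0; last by []. apply: H => j.
have [->|ji] := eqVneq j i => aji.
  apply: leq_trans ge4 _; apply: leq_sum => k _.
  by have [->|//] := eqVneq k i; rewrite a_diag.
have := leq_sum1 (fun k => a j k * (if k == i then 2 else a k i)) (x := i) (P :=
  xpredT) isT.
by rewrite /= eqxx mulnC.
Qed.

Lemma mult_le3 i j : a i j * a j i <= 3.
Proof.
by apply: leq_trans (star i); apply: (leq_sum1 (fun j => a i j * a j i)).
Qed.

Lemma nth_neq x0 (p : seq T) i j : uniq p -> i < size p -> j < size p ->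
  i != j -> nth x0 p i != nth x0 p j.
Proof. by move=> up ip jp; rewrite nth_uniq. Qed.

Lemma nth_neq_notin x0 (p : seq T) k u : u \notin p -> k < size p ->
  nth x0 p k != u.
Proof. by move=> pu kp; apply: contraNneq pu => <-; rewrite mem_nth. Qed.

(** Weight 1 on the cycle, affine A: every vertex has two distinct neighbours in it, and chords or
    multiple edges only enlarge the row sums. *)
Lemma no_cycle x0 q : uniq q -> sorted adj q -> 2 < size q ->
  adj (nth x0 q 0) (nth x0 q (size q).-1) -> False.
Proof.
move=> uq sq q2 adjc.
have adjq k : k.+1 < size q -> adj (nth x0 q k) (nth x0 q k.+1).
  by move=> kq; move/(sortedP x0): sq => /(_ _ kq).
have := a_excl (x := fun j => (j \in q) : nat).
move/(_ _ (nth x0 q 0)); rewrite mem_nth; last lia.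
move=> H; have // : true = 0 :> nat; apply: H => z.
case zq: (z \in q) => // _.
have [k kq ->] : exists2 k, k < size q & z = nth x0 q k.
  by exists (index z q); rewrite ?index_mem // nth_index.
suff [k1 [k2 [k12 k1q k2q a1 a2]]] : exists k1 k2, [/\ k1 != k2, k1 < size q,
    k2 < size q, adj (nth x0 q k) (nth x0 q k1) & adj (nth x0 q k) (nth x0 q k2)].
  have := @leq_sum2 (fun j => a (nth x0 q k) j * (j \in q)) predT
    (nth x0 q k1) (nth x0 q k2).
  rewrite nth_uniq // => /(_ k12 isT isT) /=; rewrite !mem_nth // !muln1 => le2.
  by apply: leq_trans le2; exact: leq_add a1 a2.
have [k0|k0] := posnP k.
  exists 1, (size q).-1; rewrite k0; split => //; try lia.
  by apply: adjq; lia.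
have [kl|kl] := eqVneq k (size q).-1.
  exists k.-1, 0; split => //; try lia.
    rewrite adj_sym; have := adjq k.-1; rewrite prednK //; exact.
  by rewrite adj_sym kl.
exists k.-1, k.+1; split; try lia.
  rewrite adj_sym; have := adjq k.-1; rewrite prednK //; exact.
by apply: adjq; lia.
Qed.

(** Weight 2 on [q] and [a j w + a j w'] outside. An inner vertex sees two neighbours of weight 2;
    an end sees one, and its outside neighbours contribute at least the missing 2. An end is heavy
    through two simple edges or one multiple edge, so affine B, C, D and their twisted variants are
    excluded together. *)
Lemma no_heavy_ends x0 q : uniq q -> sorted adj q -> 1 < size q ->
  let w := nth x0 q 0 in let w' := nth x0 q (size q).-1 in
  1 < \sum_(g | g \notin q) a w g * a g w ->
  1 < \sum_(g | g \notin q) a w' g * a g w' -> False.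
Proof.
move=> uq sq q2 w w' hw hw'.
have adjq k : k.+1 < size q -> adj (nth x0 q k) (nth x0 q k.+1).
  by move=> kq; move/(sortedP x0): sq => /(_ _ kq).
have wq : w \in q by rewrite mem_nth //; lia.
have w'q : w' \in q by rewrite mem_nth //; lia.
pose x j := if j \in q then 2 else a j w + a j w'.
have xw : x w = 2 by rewrite /x wq.
suff : x w = 0 by rewrite xw.
apply: a_excl => z.
have ww' : w != w' by rewrite /w /w' nth_uniq //; lia.
rewrite {1 2}/x; case zq: (z \in q) => xz; last first.
  have := leq_sum2 (fun j => a z j * x j) (P := predT) ww' isT isT.
  rewrite {1 2}/x wq w'q => le2; apply: leq_trans le2.
  by rewrite mulnDr !(mulnC 2).
have key b : b = w \/ b = w' -> \sum_(g | g \notin q) a b g * a g b <=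
    \sum_(j | j \notin q) a b j * x j.
  move=> bw; apply: leq_sum => j jq; rewrite /x (negPf jq) leq_mul2l.
  by case: bw => ->; lia.
have [k kq zE] : exists2 k, k < size q & z = nth x0 q k.
  by exists (index z q); rewrite ?index_mem // nth_index.
rewrite (bigID (mem q)) /=; set S1 := (X in _ <= X + _);
  set S2 := (X in _ <= _ + X).
have xq l : l < size q -> x (nth x0 q l) = 2 by move=> lq; rewrite /x mem_nth.
have S1_1 l : l < size q -> adj z (nth x0 q l) -> 2 <= S1.
  move=> lq zl; apply: leq_trans (leq_sum1 _ (mem_nth x0 lq)).
  by rewrite xq // (leq_mul2r 2 1) (zl : 0 < _).
have S2_w b : b = w \/ b = w' -> z = b -> 2 <= S2.
  move=> bw zb; rewrite /S2 zb; apply: leq_trans (key b bw).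
  by case: bw => ->.
have [k0|k0] := posnP k.
  have zw : z = w by rewrite zE k0.
  apply: (leq_add (S1_1 1 q2 _) (S2_w w _ zw)); last by left.
  by rewrite zw; exact: adjq.
have e1 : adj z (nth x0 q k.-1).
  by rewrite zE adj_sym; have := adjq k.-1; rewrite prednK //; exact.
have k1q : k.-1 < size q by lia.
have [kl|kl] := eqVneq k (size q).-1.
  have zw : z = w' by rewrite zE kl.
  by apply: (leq_add (S1_1 _ k1q e1) (S2_w w' _ zw)); right.
have k2q : k.+1 < size q by lia.
have e2 : adj z (nth x0 q k.+1) by rewrite zE; exact: adjq.
have k12 : nth x0 q k.-1 != nth x0 q k.+1 by rewrite nth_uniq //; lia.
apply: leq_trans (leq_addr _ _).
apply: leq_trans (leq_sum2 _ k12 (mem_nth x0 k1q) (mem_nth x0 k2q)).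
by rewrite !xq // (leq_add (m1 := 2) (m2 := 2)) // (leq_mul2r 2 1).
Qed.

Lemma adj_nth x0 p k : sorted adj p -> k.+1 < size p ->
  adj (nth x0 p k) (nth x0 p k.+1).
Proof. by move=> sp kp; move/(sortedP x0): sp => /(_ _ kp). Qed.

Definition slice i j (p : seq T) := take (j - i).+1 (drop i p).

Section Slice.
Variables (x0 : T) (p : seq T) (i j : nat).
Hypotheses (ij : i <= j) (jp : j < size p).

Lemma size_slice : size (slice i j p) = (j - i).+1.
Proof. rewrite size_takel // size_drop; lia. Qed.

Lemma nth_slice k : k <= j - i -> nth x0 (slice i j p) k = nth x0 p (i + k).
Proof. by move=> kij; rewrite nth_take ?ltnS // nth_drop. Qed.

Lemma mem_slice k : uniq p -> k < size p ->
  (nth x0 p k \in slice i j p) = (i <= k <= j).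
Proof.
move=> up kp; apply/(nthP x0)/idP => [[l] | /andP[ik kj]].
  rewrite size_slice ltnS => lij; rewrite nth_slice // => /eqP.
  have ilp : i + l < size p by lia.
  by rewrite nth_uniq // => /eqP <-; lia.
exists (k - i); first by rewrite size_slice; lia.
by rewrite nth_slice; [congr nth; lia | lia].
Qed.

End Slice.

Lemma slice_sub i j p : {subset slice i j p <= p}.
Proof. by move=> z /mem_take /mem_drop. Qed.

Lemma slice_uniq i j p : uniq p -> uniq (slice i j p).
Proof. by move=> up; rewrite take_uniq // drop_uniq. Qed.

Lemma slice_sorted i j p : sorted adj p -> sorted adj (slice i j p).
Proof. by move=> sp; rewrite take_sorted // drop_sorted. Qed.

(* Without cycles an adjacency path is an induced subgraph. *)
Lemma adj_path_consecutive x0 p i j : uniq p -> sorted adj p -> i < j -> j < size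
  p ->
  adj (nth x0 p i) (nth x0 p j) -> j = i.+1.
Proof.
move=> up sp ij jp aij; apply/eqP; apply: contraT => ji.
exfalso; have le_ij : i <= j by lia.
apply: (@no_cycle x0 (slice i j p)); rewrite ?slice_uniq ?slice_sorted //
  size_slice //; first lia.
by rewrite !nth_slice /= ?addn0 // subnKC.
Qed.

(** Two attachments of [u] would close a cycle through the slice between them, a triangle if the
    positions are consecutive. *)
Lemma adj_path_unique x0 p u i j : uniq p -> sorted adj p -> u \notin p ->
  i < size p -> j < size p -> adj u (nth x0 p i) -> adj u (nth x0 p j) -> i = j.
Proof.
move=> up sp pu; wlog ij : i j / i < j.
  move=> H ip jp ai aj; have [ij|ij|//] := ltngtP i j; first exact: H.
  by apply/esym; apply: H.
move=> ip jp ai aj; exfalso; have le_ij : i <= j by lia.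
have szs := size_slice le_ij jp.
apply: (@no_cycle x0 (u :: slice i j p)).
- rewrite cons_uniq slice_uniq // andbT.
  by apply: contra pu => /slice_sub.
- have := slice_sorted i j sp; case E: (slice i j p) => [|b r] //= ->;
    rewrite andbT.
  have := nth_slice x0 p (leq0n (j - i)).
  by rewrite E /= addn0 => ->.
- by rewrite /= szs; lia.
- by rewrite /= szs /= nth_slice // subnKC.
Qed.

(** * A longest path and the vertices attached to it *)

Section LongestPath.
Variable x0 : T.

Definition longest p := [/\ uniq p, sorted adj p &
  forall q, uniq q -> sorted adj q -> size q <= size p].

Lemma longest_rev p : longest p -> longest (rev p).
Proof.
case=> up sp lp; split; rewrite ?rev_uniq //.
  by rewrite rev_sorted; apply: sub_sorted sp => y z; rewrite adj_sym.
by rewrite size_rev.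
Qed.

Lemma longest_exists : exists2 p, longest p & 0 < size p.
Proof.
pose P k := [exists t : k.-tuple T, uniq t && sorted adj t].
have P1 : P 1 by apply/existsP; exists [tuple x0].
have Pb k : P k -> k <= #|T|.
  by move/existsP => [t /andP[/card_uniqP tk _]];
    rewrite -(size_tuple t) -tk max_card.
have exP : exists k, P k by exists 1.
case: (ex_maxnP exP Pb) => m /existsP[t /andP[ut st]] mmax.
exists t; last by rewrite size_tuple; exact: mmax.
split=> // q uq sq; rewrite size_tuple; apply: mmax.
by apply/existsP; exists (in_tuple q); rewrite uq.
Qed.

(** Reduces [a_excl] to estimates along a path: [f] weights it by position, [g] weights the rest. In
    the row of a path vertex only its path neighbours and the outside vertices are kept; the omitted
    terms are nonnegative. *)
Lemma weight_path p (f : nat -> nat) (g : T -> nat) : uniq p -> sorted adj p ->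
  (forall k, k < size p -> 0 < f k ->
     2 * f k <= (if k is k'.+1 then a (nth x0 p k) (nth x0 p k') * f k' else 0)
       + (if k.+1 < size p then a (nth x0 p k) (nth x0 p k.+1) * f k.+1 else 0)
       + \sum_(z | z \notin p) a (nth x0 p k) z * g z) ->
  (forall z, z \notin p -> 0 < g z ->
     2 * g z <= \sum_(w | w \notin p) a z w * g w
      + \sum_(w <- p) a z w * f (index w p)) ->
  forall k, k < size p -> f k = 0.
Proof.
move=> up sp Hf Hg k kp.
pose x z := if z \in p then f (index z p) else g z.
have xp l : l < size p -> x (nth x0 p l) = f l.
  by move=> lp; rewrite /x mem_nth // index_uniq.
rewrite -xp //; apply: a_excl => z.
have E : \sum_(w | w \notin p) a z w * x w = \sum_(w | w \notin p) a z w * g w.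
  by apply: eq_bigr => w /negPf wp; rewrite /x wp.
rewrite (bigID (mem p)) /= E.
have [zp|zp] := boolP (z \in p); last first.
  rewrite {1 2}/x (negPf zp) => gz; apply: leq_trans (Hg z zp gz) _.
  rewrite addnC leq_add2r -big_uniq //= big_seq [X in _ <= X]big_seq.
  by apply: leq_sum => w wp; rewrite /x wp.
have [l lp zE] : exists2 l, l < size p & z = nth x0 p l.
  by exists (index z p); rewrite ?index_mem // nth_index.
rewrite {1 2}zE xp // => fl; apply: leq_trans (Hf l lp fl) _.
rewrite -zE leq_add2r.
case: l zE lp fl => [|l] zE lp fl.
  case: ifP => // p1; apply: leq_trans (leq_sum1 _ (mem_nth x0 p1)).
  by rewrite xp.
have lp' : l < size p by lia.
case: ifP => [l2|_]; last first.
  by rewrite addn0; apply: leq_trans (leq_sum1 _ (mem_nth x0 lp')); rewrite xp.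
have l12 : nth x0 p l != nth x0 p l.+2 by rewrite nth_uniq //; lia.
apply: leq_trans (leq_sum2 _ l12 (mem_nth x0 lp') (mem_nth x0 l2)).
by rewrite !xp.
Qed.

Lemma mult_eq1 i j : a i j * a j i = 1 -> a i j = 1.
Proof. by move/eqP; rewrite muln_eq1 => /andP[/eqP]. Qed.

Lemma mult_le2 i j : adj i j -> a i j * a j i <= 2 ->
  [\/ a i j = 1 /\ a j i = 1, a i j = 1 /\ a j i = 2 | a i j = 2 /\ a j i = 1].
Proof.
rewrite /adj => aij le2; have := a_pair i j.
have [e1|[e1|[e1 e2]]] : a i j = 1 \/ a i j = 2 \/ 2 < a i j /\ 0 < a j i.
- by have := adj_mul aij; rewrite muln_gt0 => /andP[? ?]; lia.
- by rewrite e1 mul1n in le2 *; case=> [<-|[]|[]];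
    [constructor 1 | | constructor 2; lia].
- by rewrite e1 in le2 *; case=> [e|[]|[]]; [lia | constructor 3; lia | lia].
- by nia.
Qed.

Lemma mult_3 i j : a i j * a j i = 3 ->
  a i j = 1 /\ a j i = 3 \/ a i j = 3 /\ a j i = 1.
Proof.
move: (a_pair i j) => [->|[_ ->]|[_ ->]]; last by rewrite mul1n => ->; left.
  by case: (a j i) => [|[|[|m]]] //; rewrite !mulnS; lia.
by rewrite muln1 => ->; right.
Qed.

Lemma nth_index_rev p k : k < size p ->
  nth x0 (rev p) (size p - k.+1) = nth x0 p k.
Proof. by move=> kp; rewrite nth_rev; [congr nth; lia | lia]. Qed.

Lemma sorted_cons_drop p u i : sorted adj p -> i < size p -> adj u (nth x0 p i) ->
  sorted adj (u :: drop i p).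
Proof.
move=> sp ip ui; have := drop_sorted i sp.
by rewrite (drop_nth x0 ip) /= ui.
Qed.

Section HeavySlice.
Variable p : seq T.
Hypotheses (up : uniq p) (sp : sorted adj p).
Notation v := (nth x0 p).

(** The outside of the slice includes the rest of [p], so a path edge leaving the slice counts
    towards the weight of its end. *)
Lemma heavy_slice i j : i < j -> j < size p ->
  1 < \sum_(g | g \notin slice i j p) a (v i) g * a g (v i) ->
  1 < \sum_(g | g \notin slice i j p) a (v j) g * a g (v j) -> False.
Proof.
move=> ij jp hi hj; have le_ij := ltnW ij.
have szs := size_slice le_ij jp.
apply: (@no_heavy_ends x0 (slice i j p)); rewrite ?slice_uniq ?slice_sorted //.
- by rewrite szs; lia.
- by rewrite nth_slice // addn0.
- by rewrite szs /= nth_slice // subnKC.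
Qed.

Lemma notin_slice i j k : k < size p -> j < size p -> i <= j ->
  ~~ (i <= k <= j) -> v k \notin slice i j p.
Proof. by move=> kp jp ij; rewrite mem_slice. Qed.

Lemma adj_path_eq0 i j : i < size p -> j < size p ->
  ~~ ((j == i.+1) || (i == j.+1)) -> a (v i) (v j) = 0.
Proof.
move=> ip jp cij; apply/eqP; rewrite -leqn0 leqNgt; apply/negP => aij.
have [ij|ij|ij] := ltngtP i j.
- by rewrite (adj_path_consecutive up sp ij jp aij) eqxx in cij.
- have aji : adj (v j) (v i) by rewrite adj_sym.
  by rewrite (adj_path_consecutive up sp ij ip aji) eqxx orbT in cij.
- by move: aij; rewrite ij a_diag.
Qed.

(** Two multiple edges that share a vertex break the bound of [star] there; otherwise the segment
    between them has two heavy ends. *)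
Lemma double_edges_adjacent i j : i < j -> j.+1 < size p ->
  1 < a (v i) (v i.+1) * a (v i.+1) (v i) ->
  1 < a (v j) (v j.+1) * a (v j.+1) (v j) -> False.
Proof.
move=> ij jp hi hj; have [eij|neij] := eqVneq i.+1 j.
  subst j; have ne : v i != v i.+2 by apply: nth_neq => //; lia.
  have le3 := leq_trans (leq_sum2 (fun g => a (v i.+1) g * a g (v i.+1))
    (P := predT) ne isT isT) (star (v i.+1)).
  by rewrite mulnC in hi; have := leq_trans (leq_add hi hj) le3.
apply: (@heavy_slice i.+1 j); first lia; first lia.
  rewrite mulnC in hi; apply: leq_trans hi _.
  by apply: (leq_sum1 (fun g => a (v i.+1) g * a g (v i.+1))); apply: notin_slice;
    lia.
apply: leq_trans hj _.
by apply: (leq_sum1 (fun g => a (v j) g * a g (v j))); apply: notin_slice; lia.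
Qed.

(** The segment from [i] to [j] is heavy at both ends: each end has a path neighbour outside the
    segment besides its attached vertex. *)
Lemma two_branches u u' i j : u \notin p -> u' \notin p -> 0 < i -> i < j ->
  j.+1 < size p -> adj u (v i) -> adj u' (v j) -> False.
Proof.
move=> pu pu' i0 ij jp ui uj; apply: (@heavy_slice i j) => //; first lia.
- have ne : v i.-1 != u by apply: nth_neq_notin => //; lia.
  have n1 : v i.-1 \notin slice i j p by apply: notin_slice; lia.
  have n2 : u \notin slice i j p by apply: contra pu => /slice_sub.
  have e1 : adj (v i) (v i.-1).
    by rewrite adj_sym; have := @adj_nth x0 p i.-1 sp; rewrite prednK //; apply;
      lia.
  rewrite adj_sym in ui.
  apply: leq_trans (leq_sum2 (fun g => a (v i) g * a g (v i)) ne n1 n2).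
  exact: (leq_add (adj_mul e1) (adj_mul ui)).
- have ne : v j.+1 != u' by apply: nth_neq_notin.
  have n1 : v j.+1 \notin slice i j p by apply: notin_slice; lia.
  have n2 : u' \notin slice i j p by apply: contra pu' => /slice_sub.
  have e1 := adj_nth x0 sp jp.
  rewrite adj_sym in uj.
  apply: leq_trans (leq_sum2 (fun g => a (v j) g * a g (v j)) ne n1 n2).
  exact: (leq_add (adj_mul e1) (adj_mul uj)).
Qed.

(* A vertex u attached to the path at position i, and possibly a vertex w
   attached to u. *)
Lemma weight_branch u w i (f : nat -> nat) (c d : nat) :
  u \notin p -> i < size p -> adj u (v i) ->
  (0 < d -> [/\ w \notin p, w != u & adj w u]) ->
  (forall k, k < size p -> 0 < f k ->
    2 * f k <= (if k is k'.+1 then f k' else 0) +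
      (if k.+1 < size p then f k.+1 else 0) + (if k == i then c else 0)) ->
  2 * c <= f i + d -> 2 * d <= c -> f i = 0.
Proof.
move=> pu ip ui wP fP cP dP.
pose g z := if z == u then c else if z == w then d else 0.
pose out z := z \notin p.
have gu : g u = c by rewrite /g eqxx.
apply: (@weight_path p f g) => //.
  move=> k kp /(fP k kp) H; apply: leq_trans H _; apply: leq_add;
    first apply: leq_add.
  - case: k kp => // k kp; rewrite leq_pmull //.
    by have := adj_nth x0 sp kp; rewrite adj_sym.
  - by case: ifP => // k1; rewrite leq_pmull //; exact: (adj_nth x0 sp k1).
  - case: eqP => // ->.
    have := leq_sum1 (fun z => a (v i) z * g z) (P := out) pu.
    rewrite gu; apply: leq_trans; rewrite leq_pmull //.
    by rewrite adj_sym in ui.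
move=> z zp; have [-> c0|zu] := eqVneq z u.
  rewrite gu; apply: leq_trans cP _; rewrite addnC; apply: leq_add.
    have [->//|d0] := posnP d; have [wp wu aw] := wP d0.
    have := leq_sum1 (fun z => a u z * g z) (P := out) wp.
    rewrite /g (negPf wu) eqxx; apply: leq_trans.
    by rewrite leq_pmull // [0 < _]adj_sym.
  rewrite big_uniq //=.
  have := leq_sum1 (fun z => a u z * f (index z p)) (P := mem p) (mem_nth x0 ip).
  by rewrite index_uniq //; apply: leq_trans; rewrite leq_pmull.
rewrite {1 2}/g (negPf zu); have [-> d0|//] := eqVneq z w; have [wp wu aw] := wP d0.
apply: leq_trans dP _; apply: leq_trans (leq_addr _ _).
have := leq_sum1 (fun z => a w z * g z) (P := out) pu.
by rewrite gu; apply: leq_trans; rewrite leq_pmull.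
Qed.

End HeavySlice.

Lemma longest_uniq p : longest p -> uniq p. Proof. by case. Qed.

Lemma longest_sorted p : longest p -> sorted adj p. Proof. by case. Qed.

Section Branch.
Variables (p : seq T) (u : T) (i : nat).
Hypotheses (lp : longest p) (pu : u \notin p) (ip : i < size p).
Hypothesis ui : adj u (nth x0 p i).
Notation v := (nth x0 p).

(** Replacing the first [i] vertices of [p] by [u] gives a path again, which cannot be longer than
    [p]. *)
Lemma branch_gt0 : 0 < i.
Proof.
have [_ _ /(_ (u :: drop i p))] := lp.
rewrite (sorted_cons_drop (longest_sorted lp) ip ui).
have -> : uniq (u :: drop i p).
  rewrite cons_uniq drop_uniq ?(longest_uniq lp) // andbT.
  by rewrite (contra (@mem_drop _ _ _ _) pu).
by rewrite /= size_drop => /(_ isT isT); lia.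
Qed.

Lemma branch_gt1 w : w \notin p -> w != u -> adj w u -> 1 < i.
Proof.
move=> pw wu aw; have [_ _ /(_ (w :: u :: drop i p))] := lp.
have -> : sorted adj (w :: u :: drop i p).
  by have := sorted_cons_drop (longest_sorted lp) ip ui; rewrite /= aw.
have -> : uniq (w :: u :: drop i p).
  rewrite !cons_uniq inE (negPf wu) drop_uniq ?(longest_uniq lp) // andbT /=.
  by rewrite (contra (@mem_drop _ _ _ _) pu) (contra (@mem_drop _ _ _ _) pw).
by rewrite /= size_drop => /(_ isT isT); lia.
Qed.

End Branch.

Lemma rev_notin (p : seq T) u : u \notin p -> u \notin rev p.
Proof. by rewrite mem_rev. Qed.

Lemma rev_lt (p : seq T) i : i < size p -> size p - i.+1 < size (rev p).
Proof. by rewrite size_rev; lia. Qed.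

Lemma rev_adj p u i : i < size p -> adj u (nth x0 p i) ->
  adj u (nth x0 (rev p) (size p - i.+1)).
Proof. by move=> ip; rewrite nth_index_rev. Qed.

Section BranchShape.
Variables (p : seq T) (u : T) (i : nat).
Hypotheses (lp : longest p) (pu : u \notin p) (ip : i < size p).
Hypothesis ui : adj u (nth x0 p i).
Notation v := (nth x0 p).
Fact branch_i0 : 0 < i. Proof. exact: branch_gt0 lp pu ip ui. Qed.

Lemma branch_lt : i.+1 < size p.
Proof. by have := branch_gt0 (longest_rev lp) (rev_notin pu) (rev_lt ip) (rev_adj
  ip ui); lia. Qed.

Fact branch_neql : v i.-1 != u.
Proof. by apply: nth_neq_notin => //; lia. Qed.
Fact branch_neqr : v i.+1 != u.
Proof. by apply: nth_neq_notin => //; exact: branch_lt. Qed.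
Fact branch_neq : v i.-1 != v i.+1.
Proof. by have bl := branch_lt; apply: (nth_neq x0 (longest_uniq lp)); lia. Qed.
Fact branch_adjl : adj (v i) (v i.-1).
Proof.
have := @adj_nth x0 p i.-1 (longest_sorted lp).
by rewrite (prednK branch_i0) adj_sym; apply.
Qed.
Fact branch_adjr : adj (v i) (v i.+1).
Proof. exact: adj_nth (longest_sorted lp) branch_lt. Qed.
Fact branch_adju : adj (v i) u. Proof. by rewrite adj_sym. Qed.

Lemma branch_star m1 m2 m3 : m1 <= a (v i) (v i.-1) * a (v i.-1) (v i) ->
  m2 <= a (v i) (v i.+1) * a (v i.+1) (v i) -> m3 <= a (v i) u * a u (v i) ->
  m1 + m2 + m3 <= 3.
Proof.
move=> h1 h2 h3; apply: leq_trans (star (v i)).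
apply: leq_trans (leq_sum3 (fun g => a (v i) g * a g (v i)) (P := predT)
  branch_neq branch_neql branch_neqr isT isT isT).
by do 2?apply: leq_add.
Qed.

(** The three edges at the branch vertex have products at least 1, and [star] bounds their total by
    3. *)
Lemma branch_edge : a (v i) u = 1 /\ a u (v i) = 1.
Proof.
have h := branch_star (adj_mul branch_adjl) (adj_mul branch_adjr) (leqnn _).
have h1 : a (v i) u * a u (v i) = 1.
  by apply/eqP; rewrite eqn_leq (adj_mul branch_adju) andbT -(leq_add2l (1 + 1)).
split; first exact: mult_eq1.
by rewrite mulnC in h1; exact: mult_eq1 h1.
Qed.

(** A multiple edge further right would make the segment leading to it heavy at both ends, its left
    end through [u] and the preceding path vertex. At the branch vertex itself [star] is enough. *)
Lemma branch_simple_right j : i <= j -> j.+1 < size p ->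
  a (v j) (v j.+1) * a (v j.+1) (v j) = 1.
Proof.
move=> le_ij jp; have jp' := ltnW jp.
apply/eqP; rewrite eqn_leq adj_mul ?andbT ?adj_nth ?(longest_sorted lp) // leqNgt;
  apply/negP.
have [<- hj|neij] := eqVneq i j.
  by have := branch_star (adj_mul branch_adjl) hj (adj_mul branch_adju).
have ij : i < j by lia.
have i0 := branch_i0.
have n1 : v i.-1 \notin slice i j p by apply: (notin_slice (longest_uniq lp)); lia.
have n2 : u \notin slice i j p by apply: contra pu => /slice_sub.
have n3 : v j.+1 \notin slice i j p by apply: (notin_slice (longest_uniq lp)); lia.
move=> hj; apply: (heavy_slice (longest_uniq lp) (longest_sorted lp) ij jp').
  apply: leq_trans (leq_sum2 (fun g => a (v i) g * a g (v i)) branch_neql n1 n2).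
  exact: (leq_add (adj_mul branch_adjl) (adj_mul branch_adju)).
apply: leq_trans hj _.
exact: (leq_sum1 (fun g => a (v j) g * a g (v j)) n3).
Qed.

Lemma branch_cover w : w \in u :: p.
Proof.
apply/negPn/negP => wn.
have := @a_conn [set z | z \in u :: p] u w; rewrite !inE eqxx /= => /(_ isT).
rewrite inE in wn => /(_ wn) [z [w' []]].
rewrite !inE negb_or => zS /andP[w'u w'p] zw'.
have aw' : adj w' z by rewrite adj_sym.
case/orP: zS => [/eqP zu|zp].
  (* A vertex beyond [u]: since [p] is longest, both arms have length at least 2, which leaves room
     for the weights 1, 2, 3, 2, 1 of affine E_6, with 2 at [u] and 1 at [w']. *)
  subst z.
  have i1 := branch_gt1 lp pu ip ui w'p w'u aw'.
  have w'rp : w' \notin rev p by rewrite mem_rev.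
  have i2 := branch_gt1 (longest_rev lp) (rev_notin pu) (rev_lt ip) (rev_adj ip
    ui) w'rp w'u aw'.
  have := weight_branch (f := fun k => 3 - ((k - i) + (i - k))) (c := 2) (d := 1)
    (longest_uniq lp) (longest_sorted lp) pu ip ui.
  move/(_ w'); rewrite subnn => H; have // : 3 - (0 + 0) = 0; apply: H => //.
  by move=> k kp; apply: tent_superharmonic => //; lia.
have [j jp zj] : exists2 j, j < size p & z = v j.
  by exists (index z p); rewrite ?index_mem // nth_index.
rewrite zj in aw'.
have [ij|ji|ij] := ltngtP i j.
- apply: (two_branches (longest_uniq lp) (longest_sorted lp) pu w'p branch_i0 ij
    _ ui aw').
  have w'rp : w' \notin rev p by rewrite mem_rev.
  clear zj wn; have jrp : size p - j.+1 < size (rev p) by rewrite size_rev; lia.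
  have := branch_gt0 (longest_rev lp) w'rp jrp;
    rewrite nth_index_rev // => /(_ aw'); lia.
- apply: (two_branches (longest_uniq lp) (longest_sorted lp) w'p pu (branch_gt0
    lp w'p jp aw') ji branch_lt aw' ui).
(* A fourth neighbour of the branch vertex: the products there would sum to at least 4. *)
- rewrite -ij adj_sym in aw'.
  have vw : v i.-1 != w' by apply: nth_neq_notin => //; lia.
  have := @leq_sum_seq (fun g => a (v i) g * a g (v i)) [:: v i.-1; v i.+1; u;
    w'] predT.
  rewrite !big_cons big_nil addn0 /= !inE !negb_or branch_neq branch_neql
    branch_neqr /= => H.
  have vw1 : v i.+1 != w' by apply: nth_neq_notin => //; exact: branch_lt.
  have uw : u != w' by rewrite eq_sym.
  rewrite vw vw1 uw /= in H; have {}H := H isT isT.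
  by have := leq_trans (leq_add (adj_mul branch_adjl) (leq_add (adj_mul branch_adjr)
    (leq_add (adj_mul branch_adju) (adj_mul aw')))) (leq_trans H (star (v i))).
Qed.

(** Two arms of length at least 3 would carry the weights 1, 2, 3, 4, 3, 2, 1 with 2 at [u], affine
    E_7. Taking [d = 0] removes the second attached vertex, so [u] can fill the place of [w]. *)
Lemma branch_arms : i <= 2 \/ size p - i.+1 <= 2.
Proof.
have [|i3] := leqP i 2; first by left.
have [|j3] := leqP (size p - i.+1) 2; first by right.
have := weight_branch (f := fun k => 4 - ((k - i) + (i - k))) (w := u) (c := 2)
  (d := 0)
  (longest_uniq lp) (longest_sorted lp) pu ip ui.
rewrite subnn => H; have // : 4 - (0 + 0) = 0; apply: H => //.
by move=> k kp; apply: tent_superharmonic => //; lia.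
Qed.

(** An arm of length 5 opposite one of length 2 would complete affine E_8. *)
Lemma branch_arm_le4 : i = 2 -> size p <= 7.
Proof.
move=> i2; rewrite leqNgt; apply/negP => p8.
have := weight_branch (f := fun k => if k <= 2 then 2 * k.+1 else 8 - k) (w := u)
  (c := 3) (d := 0) (longest_uniq lp) (longest_sorted lp) pu ip ui.
rewrite i2 /= => H; have // : 6 = 0; apply: H => //.
by move=> k kp; exact: E8_superharmonic p8 kp.
Qed.

End BranchShape.
Section BranchClassification.
Variables (p : seq T) (u : T) (i : nat).
Hypotheses (lp : longest p) (pu : u \notin p) (ip : i < size p).
Hypothesis ui : adj u (nth x0 p i).
Notation v := (nth x0 p).

Lemma branch_simple j : j.+1 < size p -> a (v j) (v j.+1) * a (v j.+1) (v j) = 1.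
Proof.
move=> jp; have [ij|ji] := leqP i j; first exact: (branch_simple_right lp pu ip
  ui ij jp).
have jp' : size p - j.+2 < size p - j.+1 by size_lia.
have ij : size p - i.+1 <= size p - j.+2 by size_lia.
have jrp : (size p - j.+2).+1 < size (rev p) by rewrite size_rev; size_lia.
have := branch_simple_right (longest_rev lp) (rev_notin pu) (rev_lt ip)
  (rev_adj ip ui) ij jrp.
have -> : (size p - j.+2).+1 = size p - j.+1 by size_lia.
by rewrite !nth_index_rev // 1?ltnW // mulnC.
Qed.

Lemma branch_path_entry k l : k < size p -> l < size p -> a (v k) (v l) = consec
  k l.
Proof.
move=> kp lp'; case ckl: (consec k l); last first.
  by rewrite (adj_path_eq0 (longest_uniq lp) (longest_sorted lp)) //;
    move/negbT: ckl.
case/orP: ckl => /eqP E; subst.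
  by rewrite (mult_eq1 (branch_simple lp')).
by have := branch_simple kp; rewrite mulnC => /mult_eq1 ->.
Qed.

Lemma branch_entry k : k < size p -> a (v k) u = (k == i) /\ a u (v k) = (k == i).
Proof.
move=> kp; case: eqVneq => [->|ki]; first exact: (branch_edge lp pu ip ui).
have a0 : ~~ adj u (v k).
  apply: contra ki => uk; apply/eqP.
  exact: (adj_path_unique (longest_uniq lp) (longest_sorted lp) pu kp ip uk ui).
have a0' := a0; rewrite adj_sym in a0'.
by split; apply/eqP; rewrite -leqn0 leqNgt.
Qed.

Lemma branch_shape : agree (size p).+1
  (fun k l => a (nth x0 (rcons p u) k) (nth x0 (rcons p u) l)) (shapeDE i (size
    p).+1).
Proof.
move=> k l; rewrite !ltnS !nth_rcons /shapeDE /= => kp lp'.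
have [kp1|kp1] := ltnP k (size p); have [lp1|lp1] := ltnP l (size p).
- by rewrite branch_path_entry // (ltn_eqF kp1) (ltn_eqF lp1) !andbF !andbT !orbF.
- have -> : l = size p by size_lia.
  rewrite eqxx !andbF /= andbT (ltn_eqF kp1) orbF.
  by case: (branch_entry kp1).
- have -> : k = size p by size_lia.
  rewrite eqxx !andbF /= (ltn_eqF lp1) andbF.
  by case: (branch_entry lp1).
- have -> : k = size p by size_lia. 
  have -> : l = size p by size_lia.
  by rewrite eqxx a_diag andbT (gtn_eqF ip) !andbF.
Qed.

Lemma branch_finite_type_oriented :
  i.+2 = size p \/ i = 2 /\ 2 < size p - i ->
  exists2 q, uniq q /\ (forall z, z \in q) &
    finite_type (size q) (fun k l => a (nth x0 q k) (nth x0 q l)).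
Proof.
move=> H; exists (rcons p u).
  split; first by rewrite rcons_uniq pu (longest_uniq lp).
  by move=> z; rewrite mem_rcons; exact: (branch_cover lp pu ip ui).
have i0 := branch_gt0 lp pu ip ui.
rewrite size_rcons; case: H => [iL|[i2 Li]].
  have n3 : 3 < (size p).+1 by size_lia.
  apply: (TypeD n3).
  have -> : (size p).+1 - 3 = i by size_lia.
  exact: branch_shape.
have L7 := branch_arm_le4 lp pu ip ui i2.
have n5 : 5 < (size p).+1 by size_lia.
by apply: (TypeE n5) => //; rewrite -i2; exact: branch_shape.
Qed.

End BranchClassification.

(** The numbering of D_n has the branch one step before the end of the path, that of E_n has it at
    position 2. Since one arm has length at most 2, [p] or its reversal fits one of them. *)
Lemma branch_finite_type p u i : longest p -> u \notin p -> i < size p ->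
  adj u (nth x0 p i) ->
  exists2 q, uniq q /\ (forall z, z \in q) &
    finite_type (size q) (fun k l => a (nth x0 q k) (nth x0 q l)).
Proof.
move=> lp pu ip ui.
have i0 := branch_gt0 lp pu ip ui; have i1 := branch_lt lp pu ip ui.
have arms := branch_arms lp pu ip ui.
have [iL|iL] := eqVneq i.+2 (size p).
  by apply: (branch_finite_type_oriented lp pu ip ui); left.
have [i2|i2] := eqVneq i 2.
  have i3 : 2 < size p - i by rewrite i2 in i1 iL *; size_lia.
  by apply: (branch_finite_type_oriented lp pu ip ui); right.
apply: (branch_finite_type_oriented (longest_rev lp) (rev_notin pu)
  (rev_lt ip) (rev_adj ip ui)).
by rewrite size_rev; size_lia.
Qed.

(** * Diagrams consisting of a single path *)

Section PathClassification.
Variable p : seq T.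
Hypotheses (up : uniq p) (sp : sorted adj p).
Notation v := (nth x0 p).

Lemma path_entry (s : nat -> nat -> nat) :
  (forall k, k.+1 < size p -> a (v k) (v k.+1) = s k k.+1 /\ a (v k.+1) (v k) = s
    k.+1 k) ->
  (forall k l, k < size p -> l < size p -> ~~ consec k l -> s k l = 0) ->
  agree (size p) (fun k l => a (v k) (v l)) s.
Proof.
move=> s1 s0 k l kp lp; case ckl: (consec k l); last first.
  by move/negbT: ckl => ckl; rewrite s0 // (adj_path_eq0 up sp).
by case/orP: ckl => /eqP E; subst; [case: (s1 _ lp) | case: (s1 _ kp)].
Qed.

Lemma path_simple_elsewhere j k : j.+1 < size p -> k.+1 < size p -> k != j ->
  1 < a (v j) (v j.+1) * a (v j.+1) (v j) ->
  a (v k) (v k.+1) = 1 /\ a (v k.+1) (v k) = 1.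
Proof.
move=> jp kp kj hj.
suff h : a (v k) (v k.+1) * a (v k.+1) (v k) = 1.
  by split; [exact: mult_eq1 h | rewrite mulnC in h; exact: mult_eq1 h].
apply/eqP; rewrite eqn_leq adj_mul ?andbT ?adj_nth // leqNgt; apply/negP => hk.
move: kj; rewrite neq_ltn => /orP[kj|jk].
  exact: (double_edges_adjacent up sp kj jp hk hj).
exact: (double_edges_adjacent up sp jk kp hj hk).
Qed.

(* The affine diagram of type F_4: weights 1, 2, 3, 2, 1, scaled by
   s = a (v b.+1) (v b.+2) on the left of the double edge. *)
Lemma no_affineF b : b.+4 < size p ->
  1 < a (v b.+1) (v b.+2) * a (v b.+2) (v b.+1) -> False.
Proof.
move=> bp4 hj; have bp3 := ltnW bp4; have bp2 := ltnW bp3; have bp1 := ltnW bp2.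
have e0 : a (v b) (v b.+1) = 1 /\ a (v b.+1) (v b) = 1.
  by apply: (path_simple_elsewhere bp2 bp1 _ hj); rewrite neq_ltn ltnSn.
have e2 : a (v b.+2) (v b.+3) = 1 /\ a (v b.+3) (v b.+2) = 1.
  by apply: (path_simple_elsewhere bp2 bp3 _ hj); rewrite neq_ltn ltnSn orbT.
have e3 : a (v b.+3) (v b.+4) = 1 /\ a (v b.+4) (v b.+3) = 1.
  by apply: (path_simple_elsewhere bp2 bp4 _ hj); rewrite neq_ltn leqnSn orbT.
pose s := a (v b.+1) (v b.+2); pose w := [:: s; 2 * s; 3; 2; 1].
pose f k := if b <= k then nth 0 w (k - b) else 0.
have fE t : f (b + t) = nth 0 w t by rewrite /f leq_addr addKn.
have := weight_path (f := f) (g := fun _ => 0) up sp.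
move=> /(_ _ _ b.+2 bp2) H; suff : f b.+2 = 0 by rewrite -addn2 fE.
apply: H => // k kp fk.
have [t t5 kE] : exists2 t, t < 5 & k = b + t.
  move: fk; rewrite /f; case: (leqP b k) => // bk fk; exists (k - b);
    last by rewrite subnKC.
  by case: (k - b) fk => [|[|[|[|[|l]]]]] //; rewrite /w /= nth_nil.
apply: leq_trans (leq_addr _ _).
have f0 : f b = s by rewrite -[b]addn0 fE.
have f1 : f b.+1 = 2 * s by rewrite -addn1 fE.
have f2 : f b.+2 = 3 by rewrite -addn2 fE.
have f3 : f b.+3 = 2 by rewrite -addn3 fE.
have f4 : f b.+4 = 1 by rewrite -addn4 fE.
case: t t5 kE => [|[|[|[|[|//]]]]] _ ->; rewrite ?addnS addn0 ?f0 ?f1 ?f2 ?f3 ?f4.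
- by rewrite bp1 e0.1 mul1n leq_addl.
- by rewrite bp2 e0.2 -/s mul1n; lia.
- rewrite bp3 e2.1 mulnA; move: hj; rewrite -/s; move: (s) (a _ _) => s' r hj.
  by nia.
- by rewrite bp4 e2.2 e3.1.
- by rewrite e3.2 leq_addr.
Qed.

Lemma path_finite_type_A :
  (forall k, k.+1 < size p -> a (v k) (v k.+1) * a (v k.+1) (v k) <= 1) ->
  finite_type (size p) (fun k l => a (v k) (v l)).
Proof.
move=> m1; apply: TypeA; apply: path_entry => [k kp|k l _ _ /negPf -> //].
have e1 := adj_nth x0 sp kp.
have m : a (v k) (v k.+1) * a (v k.+1) (v k) = 1.
  by apply/eqP; rewrite eqn_leq m1 // adj_mul.
rewrite /consec !eqxx orbT (mult_eq1 m); split=> //.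
by rewrite mulnC in m; exact: mult_eq1 m.
Qed.

Lemma path_finite_type_B j : j.+2 = size p ->
  1 < a (v j) (v j.+1) * a (v j.+1) (v j) <= 2 ->
  finite_type (size p) (fun k l => a (v k) (v l)).
Proof.
move=> jn /andP[hj hj2]; have jp : j.+1 < size p by rewrite -jn.
have simple k : k.+1 < size p -> k != j -> a (v k) (v k.+1) = 1 /\ a (v k.+1) (v
  k) = 1.
  by move=> kp kj; exact: path_simple_elsewhere hj.
have p1 : 1 < size p by rewrite -jn.
have shape0 k l : k < size p -> l < size p -> ~~ consec k l -> shapeB (size p) k
  l = 0.
  move=> _ _; rewrite /shapeB -jn !eqSS => ckl; case: eqP => [kj|_] /=;
    last by rewrite (negPf ckl).
  case: eqP => [lj|_]; last by rewrite (negPf ckl).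
  by move: ckl; rewrite kj lj /consec eqxx.
have shape1 k : shapeB (size p) k k.+1 = if k == j then 2 else 1.
  by rewrite /shapeB -jn !eqSS andbb /consec eqxx.
have shape2 k : shapeB (size p) k.+1 k = 1.
  rewrite /shapeB -jn !eqSS /consec eqxx orbT; case: eqP => //= E.
  by case: eqP => // F; lia.
have [[a1 a2]|[a1 a2]|[a1 a2]] := mult_le2 (adj_nth x0 sp jp) hj2.
- by rewrite a1 a2 in hj.
- apply: (TypeC p1); apply: path_entry => [k kp|k l kp lp]; last first.
    by rewrite /consec orbC; exact: shape0.
  rewrite shape1 shape2; case: eqVneq => [->//|kj]; exact: simple.
- apply: (TypeB p1); apply: path_entry => [k kp|k l kp lp]; last exact: shape0.
  rewrite shape1 shape2; case: eqVneq => [->//|kj]; exact: simple.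
Qed.

Lemma path_finite_type_F : size p = 4 -> a (v 1) (v 2) = 2 -> a (v 2) (v 1) = 1 ->
  finite_type (size p) (fun k l => a (v k) (v l)).
Proof.
move=> p4 a12 a21; have h : 1 < a (v 1) (v 2) * a (v 2) (v 1) by rewrite a12 a21.
apply: TypeF => //; apply: path_entry => [k kp|k l _ _]; last first.
  by rewrite /shapeF; case: eqP => [->|_]; case: eqP => [->|_] //= /negPf ->.
have [->|k1] := eqVneq k 1; first by [].
have p2 : 2 < size p by rewrite p4.
have [-> ->] := path_simple_elsewhere p2 kp k1 h.
by move: k kp k1; rewrite p4 => -[|[|[|k]]].
Qed.

Lemma path_finite_type_G : size p = 2 -> a (v 0) (v 1) = 1 -> a (v 1) (v 0) = 3 ->
  finite_type (size p) (fun k l => a (v k) (v l)).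
Proof.
move=> p2 a01 a10; apply: TypeG => //; apply: path_entry.
  by move=> [|k]; rewrite p2.
by rewrite p2 => -[|[|k]] [|[|l]].
Qed.

Lemma mult_3_isolated w u u' : a w u * a u w = 3 -> u != u' -> ~~ adj w u'.
Proof.
move=> h uu'; apply/negP => /adj_mul e.
by have := leq_trans (leq_add (eq_leq (esym h)) e) (leq_trans (leq_sum2
  (fun g => a w g * a g w) (P := predT) uu' isT isT) (star w)).
Qed.

(** A triple edge alone exhausts the bound of [star] at both of its ends, so neither has another
    neighbour on the path. *)
Lemma mult_3_size j : j.+1 < size p -> a (v j) (v j.+1) * a (v j.+1) (v j) = 3 ->
  j = 0 /\ size p = 2.
Proof.
move=> jp h; have jp0 := ltnW jp.
have j0 : j = 0.
  case: j jp h jp0 => // j jp h jp0; have jp1 := ltnW jp0.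
  have ne : v j.+2 != v j by apply: (nth_neq x0 up) => //; rewrite gtn_eqF.
  have := mult_3_isolated h ne.
  by rewrite adj_sym adj_nth.
split=> //; subst j; apply/eqP; rewrite eqn_leq jp andbT leqNgt; apply/negP => p3.
have ne : v 0 != v 2 by apply: (nth_neq x0 up).
rewrite mulnC in h; have := mult_3_isolated h ne.
by rewrite adj_nth.
Qed.

End PathClassification.

Lemma path_finite_type p : uniq p -> sorted adj p -> (forall z, z \in p) ->
  exists2 q, uniq q /\ (forall z, z \in q) &
    finite_type (size q) (fun k l => a (nth x0 q k) (nth x0 q l)).
Proof.
move=> up sp p_all.
have urp : uniq (rev p) by rewrite rev_uniq.
have srp : sorted adj (rev p).
  by rewrite rev_sorted; apply: sub_sorted sp => y z; rewrite adj_sym.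
have rp_all z : z \in rev p by rewrite mem_rev.
pose m j := a (nth x0 p j) (nth x0 p j.+1) * a (nth x0 p j.+1) (nth x0 p j).
have [j /andP[jp hj]|none] := pickP (fun j : 'I_(size p) => (j.+1 < size p) && (1
  < m j));
  last first.
  exists p => //; apply: path_finite_type_A => // k kp.
  by have := none (Ordinal (ltnW kp)); rewrite /= kp /= => /negbT; rewrite -leqNgt.
case: j jp hj => j /= jp0 jp hj.
have [m2|m3] := leqP (m j) 2; last first.
  have h : m j = 3 by apply/eqP; rewrite eqn_leq mult_le3.
  have [j0 p2] := mult_3_size up sp jp h; subst j.
  case: (mult_3 h) => -[a01 a10].
    by exists p => //; exact: path_finite_type_G.
  exists (rev p) => //; apply: path_finite_type_G;
    rewrite ?size_rev ?nth_rev ?p2 //.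
have hm : 1 < m j <= 2 by rewrite hj.
have [jn|jn] := eqVneq j.+2 (size p).
  by exists p => //; exact: path_finite_type_B jn hm.
have hrev k : k.+1 < size p ->
    nth x0 (rev p) (size p - k.+2) = nth x0 p k.+1 /\
    nth x0 (rev p) (size p - k.+2).+1 = nth x0 p k.
  move=> kp; split; first exact: nth_index_rev.
  have -> : (size p - k.+2).+1 = size p - k.+1 by size_lia.
  by apply: nth_index_rev; exact: ltnW.
have [h1 h2] := hrev j jp.
have [j0|j0] := posnP j.
  subst j; exists (rev p) => //.
  apply: (@path_finite_type_B _ urp srp (size p - 2)); first by rewrite size_rev;
    clear m2 hm hj; size_lia.
  by rewrite h1 h2 mulnC.
have [p4|p4] := eqVneq (size p) 4.
  have j1 : j = 1 by clear m2 hm hj h1 h2; rewrite p4 in jp jn; lia.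
  subst j; have [[a1 a2]|[a1 a2]|[a1 a2]] := mult_le2 (adj_nth x0 sp jp) m2.
  - by rewrite /m a1 a2 in hj.
  - exists (rev p) => //; rewrite p4 in h1 h2.
    by apply: path_finite_type_F; rewrite ?size_rev // ?h1 ?h2.
  - by exists p => //; exact: path_finite_type_F.
(* The double edge is not at an end and the path does not have 4 vertices, so one side of the edge
   has at least two further vertices: affine F_4 fits into [p] or into its reversal. *)
exfalso; have [jp4|jp4] := ltnP j.+3 (size p).
  by case: j j0 jp4 hj {jp0 jp m2 hm jn h1 h2} => // j _ jp4 hj;
    exact: (no_affineF up sp jp4 hj).
have jE : size p = j.+3 by clear m2 hm hj h1 h2; size_lia.
have pp : 1 < j by clear m2 hm hj h1 h2; rewrite jE in p4; lia.
have p2 : size p - j.+2 = 1 by rewrite jE; lia.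
rewrite p2 in h1 h2; apply: (@no_affineF (rev p) urp srp 0).
  by rewrite size_rev jE.
by rewrite h1 h2 mulnC.
Qed.

Theorem finite_type_classification : exists2 q, uniq q /\ (forall z, z \in q) &
    finite_type (size q) (fun k l => a (nth x0 q k) (nth x0 q l)).
Proof.
have [p lp p0] := longest_exists.
have [/forallP p_all|] := boolP [forall z, z \in p].
  exact: path_finite_type (longest_uniq lp) (longest_sorted lp) p_all.
rewrite negb_forall => /existsP[z pz].
have := @a_conn [set z | z \in p] (nth x0 p 0) z; rewrite !inE mem_nth //.
move=> /(_ isT pz) [w [u []]]; rewrite !inE => wp pu wu.
have uw : adj u w by rewrite adj_sym.
apply: (@branch_finite_type p u (index w p)) => //; first by rewrite index_mem.
by rewrite nth_index.
Qed.
End LongestPath.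
End Diagram.

Require Import Defs.
From mathcomp Require Import all_boot all_order all_algebra all_fingroup.
From mathcomp Require Import all_classical all_reals all_analysis.
From mathcomp Require Import ring lra.

Import Order.TTheory GRing.Theory Num.Theory.
Local Open Scope ring_scope.

(** * Positivity of matrices *)

Section Positivity.
Variable R : realType.

(** The selecting maps need not be injective or increasing, so that passing to a submatrix is
    composition of maps. Repeated indices give determinant 0 and a simultaneous reordering changes
    no sign, so the condition agrees with [virtual_psd]. *)
Definition minors_ge0 n (M : 'M[R]_n) :=
  forall k (f : 'I_k -> 'I_n), 0 <= \det (mxsub f f M).

Lemma det_mxsub_inj k m (g : 'I_k -> 'I_m) (N : 'M[R]_m) :
  k = m -> injective g -> \det (mxsub g g N) = \det N.
Proof.
move=> km; subst m => gI; pose s := perm gI.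
have -> : mxsub g g N = row_perm s (col_perm s N).
  by apply/matrixP => i j; rewrite !mxE !permE.
rewrite row_permE col_permE !det_mulmx !det_perm mulrA mulrC mulrA.
by rewrite odd_permV -signr_addb addbb mul1r.
Qed.

Lemma virtual_psdP n (M : 'M[R]_n) : virtual_psd M <-> minors_ge0 M.
Proof.
split=> [vM k f|mM A _]; last exact: mM.
have [/injectiveP fI|/injectivePn[i [j ij fij]]] := boolP (injectiveb f);
  last first.
  by rewrite (determinant_alternate ij) // => l; rewrite !mxE fij.
case: k f fI => [|k] f fI; first by rewrite det_mx00.
pose A := finset.imset f (mem [set: 'I_k.+1]%SET).
have fA i : f i \in A by apply: imset_f; rewrite inE.
have A0 : A != finset.set0 by apply/finset.set0Pn; exists (f ord0).
have := vM A A0; rewrite /principal_minor.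
pose g i := enum_rank_in (fA ord0) (f i).
have gI : injective g.
  move=> i j /(congr1 enum_val); rewrite !enum_rankK_in //; exact: fI.
rewrite -(det_mxsub_inj _ _ gI); last first.
  by rewrite /A card_imset // cardsT card_ord.
congr (0 <= \det _); apply/matrixP => i j.
by rewrite !mxE !enum_rankK_in.
Qed.

Lemma minors_ge0_mxsub n k (f : 'I_k -> 'I_n) (M : 'M[R]_n) :
  minors_ge0 M -> minors_ge0 (mxsub f f M).
Proof. by move=> mM l g; rewrite -mxsub_comp; exact: mM. Qed.

Lemma minors_ge0_tr n (M : 'M[R]_n) : minors_ge0 M -> minors_ge0 M^T.
Proof. by move=> mM l g; rewrite -trmx_mxsub det_tr; exact: mM. Qed.

(** The determinant is affine in each diagonal entry, with the complementary principal minor as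
    slope. Iteration expands det (M + diag d) into principal minors of [M] with products of the
    [d i] as coefficients. *)
Lemma det_add_diag n (M : 'M[R]_n) (d : 'I_n -> R) (i : 'I_n) :
  \det (\matrix_(k, l) (M k l + (d k) *+ (k == l))) =
  \det (\matrix_(k, l) (M k l + (if k == i then 0 else d k) *+ (k == l))) +
  d i * \det (\matrix_(k, l) (mxsub (lift i) (lift i) M k l + (d (lift i k)) *+
    (k == l))).
Proof.
rewrite (expand_det_row _ i) [X in _ = X + _](expand_det_row _ i).
set B := \matrix_(k, l) _; set C := \matrix_(k, l) _; set D := \matrix_(k, l) _.
have cBC j : cofactor B i j = cofactor C i j.
  rewrite /cofactor; congr (_ * \det _); apply/matrixP => k l.
  by rewrite !mxE [_ == i]eq_sym (negPf (neq_lift _ _)).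
have <- : cofactor B i i = \det D.
  rewrite /cofactor addnn -signr_odd odd_double mul1r; congr (\det _).
  by apply/matrixP => k l; rewrite !mxE (inj_eq lift_inj).
rewrite (eq_bigr (fun j => C i j * cofactor C i j + d i * cofactor B i j *+ (i ==
  j))); last first.
  move=> j _; rewrite -cBC !mxE eqxx; case: (i == j) => /=;
    last by rewrite !mulr0n !addr0.
  by rewrite mulr1n mul0rn addr0 mulrDl.
rewrite big_split /=; congr (_ + _).
rewrite (bigD1 i) //= eqxx mulr1n big1 ?addr0 // => j; rewrite eq_sym => /negPf ->.
by rewrite mulr0n.
Qed.

(** In the expansion into principal minors all terms are nonnegative; the product of all [d i],
    which multiplies the empty minor 1, makes the sum positive. *)
Lemma det_minors_ge0_add_diag n (M : 'M[R]_n) (d : 'I_n -> R) :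
  minors_ge0 M -> (forall i, 0 <= d i) ->
  0 <= \det (\matrix_(k, l) (M k l + (d k) *+ (k == l))) /\
  ((forall i, 0 < d i) -> 0 < \det (\matrix_(k, l) (M k l + (d k) *+ (k == l)))).
Proof.
elim: n M d => [|n IHn] M d mM d0.
  by rewrite det_mx00; split => // _; exact: ltr01.
(* Inner induction on the number of nonzero [d i]: of the two summands of [det_add_diag], one loses
   such an entry and the other has smaller size. *)
have [m] := ubnP #|[set i | d i != 0]%SET|.
elim: m d d0 => // m IHm d d0 dm.
have [i di|dz] := pickP (fun i => d i != 0); last first.
  have dE i : d i = 0 by apply/eqP; move/negbT: (dz i); rewrite negbK.
  split; last by move=> /(_ ord0); rewrite dE ltxx.
  have -> : \matrix_(k, l) (M k l + d k *+ (k == l)) = mxsub id id M.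
    by apply/matrixP => k l; rewrite !mxE dE mul0rn addr0.
  exact: mM.
have dip : 0 < d i by rewrite lt_def di d0.
have [||D0 D1] := IHn (mxsub (lift i) (lift i) M) (d \o lift i).
- exact: minors_ge0_mxsub.
- by move=> j; exact: d0.
have [||E0 _] := IHm (fun k => if k == i then 0 else d k).
- by move=> k; case: ifP.
- rewrite -ltnS; apply: leq_trans dm; rewrite ltnS; apply: proper_card.
  apply/properP; split.
    by apply/fintype.subsetP => k; rewrite !inE; case: ifP; rewrite ?eqxx.
  by exists i; rewrite !inE ?eqxx.
rewrite (det_add_diag _ _ i); split; first by rewrite addr_ge0 // mulr_ge0 // d0.
by move=> dp; rewrite ltr_wpDl // mulr_gt0 // D1 // => j; exact: dp.
Qed.

Definition no_neg n (M : 'M[R]_n) := forall x : 'I_n -> R, (forall i, 0 <= x i) ->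
  (forall i, 0 < x i -> \sum_j M i j * x j < 0) -> forall i, x i = 0.

(* For A = supp x, the diagonal entries d i = - (M x)_i / x_i make the
   restriction of x a kernel vector of M_A + diag d. *)
Lemma virtual_psd_no_neg n (M : 'M[R]_n) : virtual_psd M -> no_neg M.
Proof.
move=> /virtual_psdP mM x x0 xM i0; apply/eqP; apply: contraT => xi0.
pose A := [set i | 0 < x i]%SET.
pose f : 'I_#|A| -> 'I_n := @enum_val _ (mem A).
have fA k : 0 < x (f k) by have := enum_valP k; rewrite inE.
pose d k := - (\sum_j M (f k) j * x j) / x (f k).
have dp k : 0 < d k by rewrite divr_gt0 // oppr_gt0 xM.
have [|_ /(_ dp)] := det_minors_ge0_add_diag (d := d) (minors_ge0_mxsub f mM).
  by move=> k; exact: ltW.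
set D := \matrix_(k, l) _ => detD.
pose v : 'cV[R]_#|A| := \col_k x (f k).
have Dv : D *m v = 0.
  apply/matrixP => k j; rewrite !mxE.
  rewrite (eq_bigr (fun l => M (f k) (f l) * x (f l) + (d k * x (f k)) *+ (k ==
    l))); last first.
    move=> l _; rewrite !mxE mulrDl; congr (_ + _).
    by have [->|_] := eqVneq k l; rewrite ?mulr1n // !mulr0n mul0r.
  rewrite big_split /= [X in _ + X](bigD1 k) //= eqxx mulr1n.
  rewrite [X in _ + (_ + X)]big1 => [|l]; last by rewrite eq_sym => /negPf ->;
    rewrite mulr0n.
  rewrite addr0.
  rewrite -(@big_enum_val _ _ _ _ (mem A) (fun l => M (f k) l * x l)) /=.
  rewrite /d divfK; last by rewrite gt_eqF.
  rewrite [X in _ - X](bigID (mem A)) /=.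
  rewrite [X in _ - (_ + X)]big1 ?addr0 ?subrr // => l; rewrite inE -leNgt => xl.
  by rewrite (le_anti (_ : x l <= 0 <= x l)) ?mulr0 // xl x0.
have Du : D \in unitmx by rewrite unitmxE unitfE gt_eqF.
have : v = 0 by rewrite -(mulKmx Du v) Dv mulmx0.
have iA : i0 \in A by rewrite inE lt_def xi0 x0.
move/matrixP => /(_ (enum_rank_in iA i0) 0); rewrite !mxE /f enum_rankK_in // => xi.
by rewrite xi eqxx in xi0.
Qed.

Lemma quadE n (M : 'M[R]_n) (x : 'cV_n) :
  (x^T *m M *m x) 0 0 = \sum_i \sum_j x i 0 * M i j * x j 0.
Proof.
rewrite mxE exchange_big /=; apply: eq_bigr => j _.
by rewrite mxE big_distrl /=; apply: eq_bigr => i _; rewrite mxE.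
Qed.

Lemma gpsdP n (M : 'M[R]_n) : generalized_psd M <->
  forall x : 'I_n -> R, 0 <= \sum_i \sum_j x i * M i j * x j.
Proof.
split=> [gM x|gM x]; last by rewrite quadE; exact: (gM (fun i => x i 0)).
have := gM (\col_i x i); rewrite quadE.
by under eq_bigr do under eq_bigr do rewrite !mxE.
Qed.

Lemma gpsd_mxsub n k (f : 'I_k -> 'I_n) (M : 'M[R]_n) :
  generalized_psd M -> generalized_psd (mxsub f f M).
Proof.
move=> gM x; have -> : mxsub f f M = rowsub f 1%:M *m M *m (rowsub f 1%:M)^T.
  by rewrite trmx_mxsub trmx1 mul_rowsub_mx mul1mx -mxsub_mul mulmx1.
have := gM ((rowsub f 1%:M)^T *m x).
by rewrite trmx_mul trmxK !mulmxA.
Qed.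

Lemma gpsd_tr n (M : 'M[R]_n) : generalized_psd M -> generalized_psd M^T.
Proof.
move=> gM x; have -> : x^T *m M^T *m x = (x^T *m M *m x)^T.
  by rewrite !trmx_mul trmxK mulmxA.
by rewrite mxE; exact: gM.
Qed.

Lemma gpsd_tr_add n (M : 'M[R]_n) : generalized_psd M -> generalized_psd (M + M^T).
Proof.
move=> gM x; rewrite mulmxDr mulmxDl mxE addr_ge0 //.
exact: (gpsd_tr gM).
Qed.

Lemma gpsd_no_neg n (M : 'M[R]_n) : generalized_psd M -> no_neg M.
Proof.
move=> /gpsdP gM x x0 xM i; apply/eqP; apply: contraT => xi0.
suff : \sum_i \sum_j x i * M i j * x j < 0 by rewrite ltNge gM.
have E k : \sum_j x k * M k j * x j = x k * \sum_j M k j * x j.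
  by rewrite big_distrr /=; apply: eq_bigr => j _; rewrite mulrA.
under eq_bigr do rewrite E.
have xi : 0 < x i by rewrite lt_def xi0 x0.
rewrite (bigD1 i) //= ltr_nwDl // ?pmulr_rlt0 ?xM // sumr_le0 // => k _.
have [xk|xk] := ltP 0 (x k); first by rewrite mulr_ge0_le0 // ltW // xM.
by rewrite (le_anti (_ : x k <= 0 <= x k)) ?mul0r // xk x0.
Qed.

(** The determinant is the value at 0 of the monic characteristic polynomial of - M^T, which is
    positive far to the right. If it were negative, a root t > 0 would give M v = - t v with v
    nonzero. The transpose converts row eigenvectors into columns. *)
Lemma det_ge0 n (M : 'M[R]_n) :
  (forall t (v : 'cV_n), 0 < t -> M *m v = - t *: v -> v = 0) -> 0 <= \det M.
Proof.
move=> kerM; pose p := char_poly (- M^T).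
have p0 : p.[0] = \det M.
  rewrite horner_coef0 char_poly_det -[- M^T]scaleN1r detZ mulrA -exprMn mulrNN
    mul1r.
  by rewrite expr1n mul1r det_tr.
rewrite -p0 leNgt; apply/negP => pneg.
have [b pb] := monic_Cauchy_bound (char_poly_monic (- M^T)).
pose c := Num.max b 0.
have [||t] := @poly_ivt R p 0 c; first by rewrite le_max lexx orbT.
  by rewrite (ltW pneg) ltW // pb // le_max lexx.
move=> /andP[t0 _] pt.
have tp : 0 < t.
  by rewrite lt_def t0 andbT; apply: contraTneq pt => ->; rewrite /root lt_eqF.
move: pt; rewrite -eigenvalue_root_char => /eigenvalueP[v].
rewrite mulmxN => /eqP; rewrite eqr_oppLR -scaleNr => /eqP /(congr1 trmx).
rewrite trmx_mul trmxK linearZ /= => /(kerM _ _ tp) /(congr1 trmx).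
by rewrite trmxK trmx0 => -> /eqP.
Qed.

Lemma gpsd_det_ge0 n (M : 'M[R]_n) : generalized_psd M -> 0 <= \det M.
Proof.
move=> gM; apply: det_ge0 => t v t0 Mv; have := gM v.
rewrite -mulmxA Mv -scalemxAr mxE mulNr oppr_ge0 pmulr_rle0 // mxE => le0.
have sq i : 0 <= v^T 0 i * v i 0 by rewrite mxE -expr2 sqr_ge0.
have : \sum_j v^T 0 j * v j 0 == 0 by rewrite eq_le le0 sumr_ge0.
rewrite psumr_eq0 // => /allP v0; apply/colP => i.
have := v0 i; rewrite mem_index_enum mxE mulf_eq0 orbb => /(_ isT)/eqP ->.
by rewrite mxE.
Qed.

Lemma gpsd_virtual_psd n (M : 'M[R]_n) : generalized_psd M -> virtual_psd M.
Proof. by move=> gM; apply/virtual_psdP => k f; exact/gpsd_det_ge0/gpsd_mxsub. Qed.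

Section SuperharmonicVector.
Variables (n : nat) (M : 'M[R]_n) (y : 'I_n -> R).
Hypothesis M_off : forall i j, i != j -> M i j <= 0.
Hypothesis y_gt0 : forall i, 0 < y i.

(** Maximum principle: let r be the maximum of v_i / y_i. If r > 0, the signs off the diagonal give
    (M v)_i >= r (M y)_i >= 0, whereas - t v_i < 0. Applied to v and - v, this rules out negative
    eigenvalues. *)
Lemma superharmonic_det_ge0 : (forall i, 0 <= \sum_j M i j * y j) -> 0 <= \det M.
Proof.
move=> My; apply: det_ge0 => t.
suff H (v : 'cV_n) : 0 < t -> M *m v = - t *: v -> forall i, v i 0 <= 0.
  move=> v t0 Mv; apply/colP => i; apply/eqP; rewrite mxE eq_le H //=.
  by rewrite -oppr_le0; have := H (- v) t0;
    rewrite mulmxN Mv scalerN => /(_ erefl i); rewrite mxE.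
move=> t0 Mv i0; rewrite leNgt; apply/negP => vi0.
case: (@arg_maxP _ _ _ i0 xpredT (fun i => v i 0 / y i) isT) => i _ imax.
set r := v i 0 / y i in imax.
have vr j : v j 0 <= r * y j by rewrite -ler_pdivrMr //; exact: imax.
have r0 : 0 < r by apply: lt_le_trans (imax i0 isT); rewrite divr_gt0.
have vi : v i 0 = r * y i by rewrite /r divfK // gt_eqF.
have : (M *m v) i 0 < 0.
  by rewrite Mv mxE mulNr oppr_lt0 mulr_gt0 // vi mulr_gt0.
apply/negP; rewrite -leNgt mxE.
apply: (@le_trans _ _ (r * \sum_j M i j * y j)); first by rewrite mulr_ge0 // ltW.
rewrite big_distrr /=; apply: ler_sum => j _; rewrite mulrCA.
have [<-|ij] := eqVneq i j; first by rewrite vi.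
by rewrite ler_wnM2l // M_off.
Qed.

(** With x_i = u_i y_i, the number 2 x' M x equals the sum of u_i^2 y_i ((M + M') y)_i minus the sum
    of M_ij y_i y_j (u_i - u_j)^2, and both parts have the right sign. *)
Lemma superharmonic_gpsd :
  (forall i, 0 <= \sum_j (M + M^T) i j * y j) -> generalized_psd M.
Proof.
move=> My; apply/gpsdP => x; pose u i := x i / y i.
have xE i : x i = u i * y i by rewrite /u divfK // gt_eqF.
have H : 0 <= \sum_i (u i ^+ 2 * y i) * \sum_j (M + M^T) i j * y j.
  by apply: sumr_ge0 => i _; rewrite mulr_ge0 // mulr_ge0 ?sqr_ge0 // ltW.
rewrite -(@pmulr_rge0 _ 2) //; apply: le_trans H _.
have -> : \sum_i (u i ^+ 2 * y i) * (\sum_j (M + M^T) i j * y j) =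
  \sum_i \sum_j M i j * (y i * y j * (u i ^+ 2 + u j ^+ 2)).
  transitivity (\sum_i \sum_j M i j * (y i * y j * u i ^+ 2) +
                \sum_i \sum_j M j i * (y j * y i * u i ^+ 2)).
    rewrite -big_split; apply: eq_bigr => i _; rewrite -big_split big_distrr.
    by apply: eq_bigr => j _; rewrite !mxE /=; ring.
  rewrite [X in _ + X]exchange_big -big_split; apply: eq_bigr => i _.
  by rewrite -big_split; apply: eq_bigr => j _ /=; ring.
rewrite big_distrr; apply: ler_sum => i _; rewrite big_distrr;
  apply: ler_sum => j _ /=.
have -> : 2 * (x i * M i j * x j) = M i j * (y i * y j * (2 * u i * u j)).
  by rewrite !xE; ring.
have [<-|ij] := eqVneq i j.
  by rewrite (_ : u i ^+ 2 + u i ^+ 2 = 2 * u i * u i) ?lexx //; ring.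
rewrite ler_wnM2l ?M_off // ler_wpM2l ?mulr_ge0 ?(ltW (y_gt0 _)) //.
rewrite -subr_ge0; have -> : u i ^+ 2 + u j ^+ 2 - 2 * u i * u j = (u i - u j) ^+
  2 by ring.
exact: sqr_ge0.
Qed.

End SuperharmonicVector.

(** Passing to a principal submatrix drops from each row only off-diagonal terms M_ij y_j, all
    nonpositive, so the restricted [y] still satisfies the row inequalities. *)
Lemma superharmonic_virtual_psd n (M : 'M[R]_n) (y : 'I_n -> R) :
  (forall i j, i != j -> M i j <= 0) -> (forall i, 0 < y i) ->
  (forall i, 0 <= \sum_j M i j * y j) -> virtual_psd M.
Proof.
move=> M_off y0 My; apply/virtual_psdP => k f.
have [/injectiveP fI|/injectivePn[i [j ij fij]]] := boolP (injectiveb f);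
  last first.
  by rewrite (determinant_alternate ij) // => l; rewrite !mxE fij.
apply: (@superharmonic_det_ge0 _ _ (y \o f)) => [i j ij|i|i].
- by rewrite mxE M_off // (inj_eq fI).
- exact: y0.
apply: le_trans (My (f i)) _; under [leRHS]eq_bigr do rewrite mxE /=.
pose A := finset.imset f (mem [set: 'I_k]%SET).
rewrite [leRHS](eq_bigl (fun j => j \in [set: 'I_k]%SET)) => [|j];
  last by rewrite inE.
rewrite -(@big_imset _ _ _ _ _ f _ (fun l => M (f i) l * y l)) /=; last first.
  by move=> a b _ _; exact: fI.
rewrite (bigID (mem A)) /= gerDl.
apply: sumr_le0 => l lf; rewrite mulr_le0_ge0 ?(ltW (y0 _)) // M_off //.
by apply: contraNneq lf => <-; rewrite imset_f // inE.
Qed.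

Lemma superharmonic_psd n (M : 'M[R]_n) (y : 'I_n -> R) : M^T = M ->
  (forall i j, i != j -> M i j <= 0) -> (forall i, 0 < y i) ->
  (forall i, 0 <= \sum_j M i j * y j) -> psd M.
Proof.
move=> MT M_off y0 My; split => //; apply: (superharmonic_gpsd M_off y0) => i.
rewrite MT; under eq_bigr do rewrite mxE mulrDl.
by rewrite big_split addr_ge0 ?My.
Qed.

End Positivity.

(** * Trigonometric identities *)

Section Trigonometry.
Variable R : realType.
Implicit Types x : R.

Lemma cos_triple x : cos (3 * x) = 4 * cos x ^+ 3 - 3 * cos x.
Proof.
have -> : 3 * x = x + x + x by ring.
rewrite !cosD !sinD.
transitivity (cos x ^+ 3 - 3 * cos x * sin x ^+ 2); first by ring.
by rewrite sin2cos2; ring.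
Qed.

Lemma cos_double x : cos (2 * x) = 2 * cos x ^+ 2 - 1.
Proof. by rewrite mulr_natl cos_mulr2n mulr_natl. Qed.

Lemma cos_quintuple x : cos (5 * x) = 16 * cos x ^+ 5 - 20 * cos x ^+ 3 + 5 * cos x.
Proof.
have -> : 5 * x = 3 * x + 2 * x by ring.
have -> : cos (3 * x + 2 * x) = 2 * cos (3 * x) * cos (2 * x) - cos (3 * x - 2 * x).
  by rewrite cosD cosB; ring.
have -> : 3 * x - 2 * x = x by ring.
by rewrite cos_triple cos_double; ring.
Qed.

Lemma sin_consecutive x (k : nat) :
  sin (k%:R * x) + sin (k.+2%:R * x) = 2 * cos x * sin (k.+1%:R * x).
Proof.
have -> : k%:R * x = k.+1%:R * x - x by rewrite -[k.+1]addn1 natrD; ring.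
have -> : k.+2%:R * x = k.+1%:R * x + x by rewrite -[k.+2]addn1 natrD; ring.
by rewrite sinB sinD; ring.
Qed.

Lemma cos_pi3 : cos (pi / 3) = 2^-1 :> R.
Proof.
have := cos_triple (pi / 3); have -> : 3 * (pi / 3) = pi :> R by field.
rewrite cospi; set c := cos _ => E.
have c0 : 0 < c.
  by apply: cos_gt0_pihalf; have := pi_gt0 R; lra.
have : (c + 1) * (2 * c - 1) ^+ 2 == 0.
  by apply/eqP; transitivity (4 * c ^+ 3 - 3 * c + 1); [ring | rewrite -E; ring].
rewrite mulf_eq0 expf_eq0 /= => /orP[/eqP|/eqP]; lra.
Qed.

Lemma cos_pi6_gt0 : 0 < cos (pi / 6) :> R.
Proof. by apply: cos_gt0_pihalf; have := pi_gt0 R; lra. Qed.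

Lemma cos_pi6_sq : cos (pi / 6) ^+ 2 = 3 / 4 :> R.
Proof.
have := cos_double (pi / 6); have -> : 2 * (pi / 6) = pi / 3 :> R by field.
by rewrite cos_pi3 => E; lra.
Qed.

Lemma cos_lt x y : 0 <= x -> x < y -> y <= pi -> cos y < cos x.
Proof.
by move=> x0 xy yp; rewrite ltr_cos // in_itv /=; apply/andP; split; lra.
Qed.

(* The polynomials below are factors of the characteristic polynomials of the
   adjacency matrices of E_6 (and F_4), E_7 and E_8. *)
Lemma two_cos_pi12 : let l : R := 2 * cos (pi / 12) in
  [/\ 0 < l, 3 < l ^+ 2 & l ^+ 4 - 4 * l ^+ 2 + 1 = 0].
Proof.
move=> l; have p0 := pi_gt0 R.
have c0 : 0 < cos (pi / 12) :> R by apply: cos_gt0_pihalf; lra.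
have E := cos_double (pi / 12); have E6 : 2 * (pi / 12) = pi / 6 :> R by field.
rewrite E6 in E; have c6 := cos_pi6_sq; have c60 := cos_pi6_gt0.
have lE : l ^+ 2 = 2 + 2 * cos (pi / 6) by rewrite E /l; ring.
split; first by rewrite /l; lra.
  rewrite lE; have : 1 / 2 < cos (pi / 6) :> R by nra. lra.
have -> : l ^+ 4 = (l ^+ 2) ^+ 2 by ring.
rewrite lE; transitivity (4 * cos (pi / 6) ^+ 2 - 3 : R); first by ring.
by rewrite c6; field.
Qed.

Lemma two_cos_pi18 : let l : R := 2 * cos (pi / 18) in
  [/\ 0 < l, 3 < l ^+ 2 & l ^+ 6 - 6 * l ^+ 4 + 9 * l ^+ 2 - 3 = 0].
Proof.
move=> l; have p0 := pi_gt0 R.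
have c0 : 0 < cos (pi / 18) :> R by apply: cos_gt0_pihalf; lra.
have E := cos_double (pi / 18); have E6 : 2 * (pi / 18) = pi / 9 :> R by field.
rewrite E6 in E.
have c9 : 2^-1 < cos (pi / 9) :> R by rewrite -cos_pi3; apply: cos_lt; lra.
have := cos_triple (pi / 9); have -> : 3 * (pi / 9) = pi / 3 :> R by field.
rewrite cos_pi3 => c93.
have lE : l ^+ 2 = 2 + 2 * cos (pi / 9) by rewrite E /l; ring.
split; first by rewrite /l; lra.
  by rewrite lE; lra.
have -> : l ^+ 6 = (l ^+ 2) ^+ 3 by ring.
have -> : l ^+ 4 = (l ^+ 2) ^+ 2 by ring.
rewrite lE; transitivity (2 * (4 * cos (pi / 9) ^+ 3 - 3 * cos (pi / 9)) - 1 : R);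
  first by ring.
by rewrite -c93; field.
Qed.

Lemma two_cos_pi30 : let l : R := 2 * cos (pi / 30) in
  [/\ 0 < l, 3 < l ^+ 2 & l ^+ 8 - 7 * l ^+ 6 + 14 * l ^+ 4 - 8 * l ^+ 2 + 1 = 0].
Proof.
move=> l; have p0 := pi_gt0 R.
have c0 : 0 < cos (pi / 30) :> R by apply: cos_gt0_pihalf; lra.
have E := cos_double (pi / 30); have E6 : 2 * (pi / 30) = pi / 15 :> R by field.
rewrite E6 in E.
have c9 : 2^-1 < cos (pi / 15) :> R by rewrite -cos_pi3; apply: cos_lt; lra.
have := cos_quintuple (pi / 15); have -> : 5 * (pi / 15) = pi / 3 :> R by field.
rewrite cos_pi3 => c93.
have lE : l ^+ 2 = 2 + 2 * cos (pi / 15) by rewrite E /l; ring.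
split; first by rewrite /l; lra.
  by rewrite lE; lra.
have -> : l ^+ 8 = (l ^+ 2) ^+ 4 by ring.
have -> : l ^+ 6 = (l ^+ 2) ^+ 3 by ring.
have -> : l ^+ 4 = (l ^+ 2) ^+ 2 by ring.
rewrite lE; set c := cos _ in c93 c9 *.
(* The quintic also has the root 1 / 2, from the angle pi / 3, whose fivefold has the same cosine;
   [c9] excludes it and leaves the quartic factor. *)
apply/eqP; have : (2 * c - 1) * (16 * c ^+ 4 + 8 * c ^+ 3 - 16 * c ^+ 2 - 8 * c +
  1) == 0.
  apply/eqP; transitivity (2 * (16 * c ^+ 5 - 20 * c ^+ 3 + 5 * c) - 1);
    first by ring.
  by rewrite -c93; field.
rewrite mulf_eq0 => /orP[/eqP|/eqP <-]; first by lra.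
by apply/eqP; ring.
Qed.

(** Trigonometric solution of a cubic: the cosine of [atan x] is [r^-1], so [c] solves the
    triple-angle equation. The angle lies below pi / 6, which bounds [c] from below. *)
Lemma cos_third_atan x r : 0 < x -> 0 < r -> 1 + x ^+ 2 = r ^+ 2 ->
  let c := cos (3^-1 * atan x) in
  [/\ 0 < c, 3 / 4 < c ^+ 2, 0 < sin (3^-1 * atan x) & 4 * c ^+ 3 - 3 * c = r^-1].
Proof.
move=> x0 r0 xr c; have p0 := pi_gt0 R.
have a0 : 0 < atan x by rewrite -(atan0 R); exact: lt_atan.
have a1 := atan_ltpi2 x.
have c6 : cos (pi / 6) < c by apply: cos_lt; lra.
have c60 := cos_pi6_gt0; have c62 := cos_pi6_sq.
split.
- exact: lt_trans c6.
- by rewrite -c62; nra.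
- by apply: sin_gt0_pi; lra.
- rewrite -cos_triple; have -> : 3 * (3^-1 * atan x) = atan x by field.
  by rewrite cos_atan xr sqrtr_sqr gtr0_norm.
Qed.

End Trigonometry.

Section SquareRoots.
Variable R : realType.

Lemma sqrt_nat_sq (k : nat) : Num.sqrt k%:R ^+ 2 = k%:R :> R.
Proof. by rewrite sqr_sqrtr // ler0n. Qed.

Lemma sqrt_nat_gt0 (k : nat) : (0 < k)%N -> 0 < Num.sqrt k%:R :> R.
Proof. by move=> k0; rewrite sqrtr_gt0 ltr0n. Qed.

End SquareRoots.

(** * The bounds mu_n *)

Section Chebyshev.
Variable R : realType.

(* Chebyshev polynomials of the second kind, cheb l k = U_(k-1) (l / 2). *)
Fixpoint cheb (l : R) (k : nat) : R :=
  if k is k1.+1 then (if k1 is k2.+1 then l * cheb l k1 - cheb l k2 else 1) else 0.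

Lemma chebSS l k : cheb l k.+2 = l * cheb l k.+1 - cheb l k. Proof. by []. Qed.

(** U_(k-1) (l / 2) is positive beyond its largest root 2 cos (pi / k). The constant 10 / 3 lies
    above 4 cos^2 (pi / 7), about 3.247, and below mu_n^2 for n from 4 to 8. *)
Lemma cheb_gt0 l k : 0 < l -> 10 / 3 <= l ^+ 2 -> (0 < k <= 7)%N -> 0 < cheb l k.
Proof.
move=> l0 y0; case: k => [|[|[|[|[|[|[|[|k]]]]]]]] // _ /=.
- by rewrite subr0 mulr1.
- lra.
- rewrite (_ : _ - _ = l * (l ^+ 2 - 2)); last by ring.
  by rewrite mulr_gt0 //; lra.
- rewrite (_ : _ - _ = (l ^+ 2) * (l ^+ 2 - 3) + 1); last by ring.
  by rewrite ltr_wpDl // mulr_ge0 ?sqr_ge0 //; lra.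
- rewrite (_ : _ - _ = l * ((l ^+ 2 - 1) * (l ^+ 2 - 3))); last by ring.
  by rewrite mulr_gt0 // mulr_gt0 //; lra.
- pose m := l ^+ 2 - 10 / 3; have m0 : 0 <= m by rewrite /m; lra.
  rewrite (_ : _ - _ = m ^+ 3 + 5 * m ^+ 2 + 6 * m + 13 / 27); last by rewrite /m;
    field.
  by rewrite ltr_wpDl // !addr_ge0 ?mulr_ge0 // exprn_ge0.
Qed.

(** Here the square of the largest root is 2 + sqrt 2, already beyond 10 / 3. *)
Lemma cheb_8_gt0 l : 0 < l -> 7 / 2 <= l ^+ 2 -> 0 < cheb l 8.
Proof.
move=> l0 y0; rewrite (_ : cheb l 8 = l * ((l ^+ 2 - 2) * ((l ^+ 2 - 2) ^+ 2 -
  2))) /=; last by ring.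
rewrite mulr_gt0 // mulr_gt0 //; first by lra.
by nra.
Qed.

(* The equation says that (cheb l 1, .., cheb l n.-1, 2 / 3 * cheb l n) is an
   eigenvector for l of the path whose last edge has weight 3 / 2. *)
Definition mu_spec (n : nat) (l : R) :=
  (forall k, (0 < k <= n)%N -> 0 < cheb l k) /\ 9 * cheb l n.-1 = 4 * l * cheb l n.

Lemma mu_spec2 : mu_spec 2 (mu_bound 2).
Proof.
split; last by rewrite /mu_bound /=; field.
by move=> [|[|[|k]]] //= _; rewrite /mu_bound; lra.
Qed.

Lemma mu_spec3 : mu_spec 3 (mu_bound 3).
Proof.
have E : (mu_bound 3 : R) ^+ 2 = 13 / 4.
  by rewrite /mu_bound expr_div_n sqr_sqrtr //; field.
have p : 0 < mu_bound 3 :> R by rewrite /mu_bound divr_gt0 // sqrtr_gt0.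
set l := mu_bound 3 in E p *.
split; first by move=> [|[|[|[|k]]]] //= _; lra.
rewrite /=; apply/eqP; rewrite -subr_eq0; apply/eqP.
by transitivity (l * (13 - 4 * l ^+ 2)); [ring | rewrite E; field].
Qed.

Lemma mu_spec4 : mu_spec 4 (mu_bound 4).
Proof.
have s2 : Num.sqrt 145 ^+ 2 = 145 :> R by exact: (sqrt_nat_sq R 145).
have s0 : 0 <= Num.sqrt 145 :> R by exact: sqrtr_ge0.
have s12 : 12 <= Num.sqrt 145 :> R by nra.
have E : (mu_bound 4 : R) ^+ 2 = 17 / 8 + Num.sqrt 145 / 8.
  by rewrite /mu_bound sqr_sqrtr //; lra.
have p : 0 < mu_bound 4 :> R by rewrite /mu_bound sqrtr_gt0; lra.
set l := mu_bound 4 in E p *.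
have y0 : 10 / 3 <= l ^+ 2 by rewrite E; lra.
split=> [k /andP[k0 k4]|].
  by apply: cheb_gt0 => //; rewrite k0; apply: leq_trans k4 _.
rewrite /=; apply/eqP; rewrite -subr_eq0; apply/eqP.
transitivity (- (4 * (l ^+ 2) ^+ 2 - 17 * l ^+ 2 + 9)); first by ring.
rewrite E; transitivity (- (Num.sqrt 145 ^+ 2 - 145) / 16 : R); first by field.
by rewrite s2; field.
Qed.

Lemma mu_spec5 : mu_spec 5 (mu_bound 5).
Proof.
have s2 : Num.sqrt 89 ^+ 2 = 89 :> R by exact: (sqrt_nat_sq R 89).
have s0 : 0 <= Num.sqrt 89 :> R by exact: sqrtr_ge0.
have s12 : 9 <= Num.sqrt 89 :> R by nra.
have E : (mu_bound 5 : R) ^+ 2 = 21 / 8 + Num.sqrt 89 / 8.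
  by rewrite /mu_bound sqr_sqrtr //; lra.
have p : 0 < mu_bound 5 :> R by rewrite /mu_bound sqrtr_gt0; lra.
set l := mu_bound 5 in E p *.
have y0 : 10 / 3 <= l ^+ 2 by rewrite E; lra.
split=> [k /andP[k0 k4]|].
  by apply: cheb_gt0 => //; rewrite k0; apply: leq_trans k4 _.
rewrite /=; apply/eqP; rewrite -subr_eq0; apply/eqP.
transitivity (- (l * (4 * (l ^+ 2) ^+ 2 - 21 * l ^+ 2 + 22))); first by ring.
rewrite E; transitivity (- (l * ((Num.sqrt 89 ^+ 2 - 89) / 16)) : R);
  first by field.
by rewrite s2; field.
Qed.

Lemma mu_spec6 : mu_spec 6 (mu_bound 6).
Proof.
have s2 : Num.sqrt 157 ^+ 2 = 157 :> R by exact: (sqrt_nat_sq R 157).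
have s0 : 0 < Num.sqrt 157 :> R by exact: (@sqrt_nat_gt0 R 157).
have s12 : 12 <= Num.sqrt 157 :> R by nra.
have q2 : Num.sqrt 1327 ^+ 2 = 1327 :> R by exact: (sqrt_nat_sq R 1327).
have q0 : 0 < Num.sqrt 1327 :> R by exact: (@sqrt_nat_gt0 R 1327).
have [|||c0 c2 _ c3] := @cos_third_atan R (54 * Num.sqrt 1327 / 19) (157 *
  Num.sqrt 157 / 19).
- by move: (Num.sqrt 1327) q0 => q q0; clear - q0; lra.
- by move: (Num.sqrt 157) s0 => s s0; clear - s0; lra.
- move: (Num.sqrt 1327) (Num.sqrt 157) q2 s2 => q s q2 s2.
  by rewrite !expr_div_n !exprMn s2 q2; field.
rewrite -/(theta1 R) in c0 c2 c3.
have E : (mu_bound 6 : R) ^+ 2 = 25 / 12 + Num.sqrt 157 / 6 * cos (theta1 R).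
  rewrite /mu_bound sqr_sqrtr; first reflexivity.
  by move: (cos _) (Num.sqrt _) c0 s0 => c s c0 s0; clear - c0 s0;
    have := mulr_gt0 s0 c0; lra.
move: (cos (theta1 R)) c0 c2 c3 E => c c0 c2 c3 E.
move: (Num.sqrt 157) s2 s0 s12 c3 E => s s2 s0 s12 c3 E.
(* Substituting l^2 = 25 / 12 + g / 6 removes the square term of the cubic 4 y^3 - 25 y^2 + 39 y - 9
   in y = l^2 and leaves this equation for g = s c. *)
have g3 : 4 * (s * c) ^+ 3 - 471 * (s * c) = 19.
  transitivity (s * 157 * (4 * c ^+ 3 - 3 * c) + 4 * (s ^+ 2 - 157) * s * c ^+ 3);
    first by ring.
  by rewrite c3 s2; field; rewrite gt_eqF.
have c45 : 4 / 5 <= c by nra.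
have y0 : 10 / 3 <= (mu_bound 6 : R) ^+ 2 by rewrite E; nra.
have p : 0 < mu_bound 6 :> R.
  by rewrite lt_def sqrtr_ge0 andbT; apply: contraTneq y0 => ->;
    rewrite expr0n /= -ltNge; clear; lra.
move: (mu_bound 6) E y0 p => l E y0 p.
split=> [k /andP[k0 k4]|].
  by apply: cheb_gt0 => //; rewrite k0; apply: leq_trans k4 _.
rewrite /=; apply/eqP; rewrite -subr_eq0; apply/eqP.
transitivity (- (4 * (l ^+ 2) ^+ 3 - 25 * (l ^+ 2) ^+ 2 + 39 * l ^+ 2 - 9));
  first by ring.
rewrite E; transitivity (- (4 * (s * c) ^+ 3 - 471 * (s * c) - 19) / 216);
  first by field.
by rewrite g3; field.
Qed.

Lemma mu_spec7 : mu_spec 7 (mu_bound 7).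
Proof.
have r2 : Num.sqrt 3 ^+ 2 = 3 :> R by exact: (sqrt_nat_sq R 3).
have r0 : 0 < Num.sqrt 3 :> R by exact: (@sqrt_nat_gt0 R 3).
have q2 : Num.sqrt 11919 ^+ 2 = 11919 :> R by exact: (sqrt_nat_sq R 11919).
have q0 : 0 < Num.sqrt 11919 :> R by exact: (@sqrt_nat_gt0 R 11919).
have [|||c0 _ d0 c3] := @cos_third_atan R (12 * Num.sqrt 11919 / 235) (1331 / 235).
- by move: (Num.sqrt 11919) q0 => q q0; clear - q0; lra.
- by clear; lra.
- move: (Num.sqrt 11919) q2 => q q2.
  by rewrite !expr_div_n !exprMn q2; field.
rewrite -/(theta2 R) in c0 d0 c3.
have E : (mu_bound 7 : R) ^+ 2 =
    29 / 12 + 11 / 12 * cos (theta2 R) + 11 * Num.sqrt 3 / 12 * sin (theta2 R).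
  rewrite /mu_bound sqr_sqrtr; first reflexivity.
  move: (cos _) (sin _) (Num.sqrt _) c0 d0 r0 => c d r c0 d0 r0; clear - c0 d0 r0.
  by have := mulr_gt0 r0 d0; lra.
have cs := cos2Dsin2 (theta2 R).
move: (cos (theta2 R)) (sin (theta2 R)) c0 d0 c3 cs E => c d c0 d0 c3 cs E.
move: (Num.sqrt 3) r2 r0 E => r r2 r0 E.
(* This is the cosine of theta2 - pi / 3. Tripling the angle subtracts pi, hence the minus sign in
   [w3]. *)
pose w := (c + r * d) / 2.
have {}E : (mu_bound 7 : R) ^+ 2 = 29 / 12 + 11 / 6 * w by rewrite E /w; field.
have w3 : 4 * w ^+ 3 - 3 * w = - (235 / 1331).
  have -> : 235 / 1331 = 4 * c ^+ 3 - 3 * c by rewrite c3; field.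
  have d2 : d ^+ 2 = 1 - c ^+ 2 by rewrite -cs; ring.
  transitivity ((c ^+ 3 + 3 * c ^+ 2 * r * d + 3 * c * r ^+ 2 * d ^+ 2 +
    r ^+ 2 * r * d * d ^+ 2 - 3 * c - 3 * r * d) / 2); first by rewrite /w; field.
  by rewrite r2 d2; field.
have w1 : 1 / 2 <= w.
  have : 1 <= (c + r * d) ^+ 2.
    have -> : (c + r * d) ^+ 2 = (c ^+ 2 + d ^+ 2) + 2 * d ^+ 2 + 2 * c * (r * d)
      + (r ^+ 2 - 3) * d ^+ 2 by ring.
    rewrite cs r2 subrr mul0r addr0 -addrA lerDl addr_ge0 // ?mulr_ge0 ?sqr_ge0
      ?ltW //.
  have : 0 < c + r * d by rewrite addr_gt0 // mulr_gt0.
  by rewrite /w; move: (c + r * d) => x; clear; nra.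
have y0 : 10 / 3 <= (mu_bound 7 : R) ^+ 2 by rewrite E; clear - w1; lra.
have p : 0 < mu_bound 7 :> R.
  by rewrite lt_def sqrtr_ge0 andbT; apply: contraTneq y0 => ->;
    rewrite expr0n /= -ltNge; clear; lra.
move: (mu_bound 7) E y0 p => l E y0 p.
split=> [k /andP[k0 k4]|].
  by apply: cheb_gt0 => //; rewrite k0; apply: leq_trans k4 _.
rewrite /=; apply/eqP; rewrite -subr_eq0; apply/eqP.
transitivity (- (l * (4 * (l ^+ 2) ^+ 3 - 29 * (l ^+ 2) ^+ 2 + 60 * l ^+ 2 - 31)));
  first by ring.
rewrite E; transitivity (- (l * (1331 / 216 * (4 * w ^+ 3 - 3 * w + 235 / 1331))));
  first by field.
by rewrite w3; field.
Qed.

End Chebyshev.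

Section Bounds.
Variable R : realType.

(** The cubic is the resolvent of the quartic for mu_8^2. The two bounds keep [beta8] and the inner
    radicand of mu_8 away from 0. *)
Lemma alpha8_spec : [/\ 23 <= alpha8 R, alpha8 R <= 27 &
  8 * alpha8 R ^+ 3 - 4362 * alpha8 R = 34 * 1000 + 607].
Proof.
have s2 : Num.sqrt 727 ^+ 2 = 727 :> R by exact: (sqrt_nat_sq R 727).
have s0 : 0 < Num.sqrt 727 :> R by exact: (@sqrt_nat_gt0 R 727).
pose D : R := (37 * 1000 + 701) * 1000 + 987.
have D0 : 0 < D by rewrite /D; clear; lra.
have q2 : Num.sqrt D ^+ 2 = D by rewrite sqr_sqrtr // ltW.
have q0 : 0 < Num.sqrt D by rewrite sqrtr_gt0.
pose N : R := 34 * 1000 + 607.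
have N0 : 0 < N by rewrite /N; clear; lra.
have [|||c0 c2 _ c3] := @cos_third_atan R (3 * Num.sqrt D / N) (1454 * Num.sqrt
  727 / N).
- by rewrite divr_gt0 // mulr_gt0.
- refine (divr_gt0 _ N0); refine (mulr_gt0 _ s0); clear; lra.
- rewrite !expr_div_n !exprMn s2 q2.
  have N2 : N ^+ 2 != 0 by rewrite expf_neq0 // gt_eqF.
  apply: (mulIf N2); rewrite mulrDl !divfK // mul1r /N /D; clear; ring.
rewrite /alpha8 -/D -/N; set c := cos _ in c0 c2 c3 *.
have c1 : c <= 1 by exact: cos_le1.
clearbody D; move: (Num.sqrt 727) s2 s0 c3 => s s2 s0 c3.
have E : 8 * (s * c) ^+ 3 - 4362 * (s * c) = N.
  transitivity (2 * s * 727 * (4 * c ^+ 3 - 3 * c) + 8 * (s ^+ 2 - 727) * s * c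
    ^+ 3);
    first by clear; ring.
  rewrite c3 s2; clear - s0 N0; field; rewrite !gt_eqF //.
split=> //.
- have : 545 < (s * c) ^+ 2 by rewrite exprMn s2; clear - c2; lra.
  by have := mulr_gt0 s0 c0; move: (s * c) => x; clear; nra.
- have s27 : s <= 27 by clear - s2 s0; nra.
  clear - s27 c1 c0 s0; nra.
Qed.

Lemma mu_spec8 : mu_spec 8 (mu_bound 8 : R).
Proof.
have [a23 a27 a3] := alpha8_spec.
have b2 : beta8 R ^+ 2 = 547 / 3 + 32 / 3 * alpha8 R.
  rewrite sqr_sqrtr; first reflexivity.
  by move: (alpha8 R) a23 => x; clear; lra.
have b20 : 20 <= beta8 R.
  have := sqrtr_ge0 (547 / 3 + 32 / 3 * alpha8 R); rewrite -/(beta8 R) => b0.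
  by clear - b0 b2 a23; nra.
have E : (mu_bound 8 : R) ^+ 2 = 33 / 16 + beta8 R / 16 +
    2^-1 * Num.sqrt (547 / 96 - alpha8 R / 6 + 17 / (32 * beta8 R)).
  rewrite /mu_bound sqr_sqrtr; first reflexivity.
  have := sqrtr_ge0 (547 / 96 - alpha8 R / 6 + 17 / (32 * beta8 R)).
  by move: (Num.sqrt _) => x; clear - b20; lra.
move: (alpha8 R) (beta8 R) a23 a27 a3 b2 b20 E => al b a23 a27 a3 b2 b20 E.
have u1 : 1 <= 547 / 96 - al / 6 + 17 / (32 * b).
  have : 0 <= 17 / (32 * b) by rewrite divr_ge0 ?mulr_ge0 //; clear - b20; lra.
  by move: (17 / _) => x; clear - a27; lra.
have s2 := sqr_sqrtr (le_trans ler01 u1).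
have s1 := sqrtr_ge0 (547 / 96 - al / 6 + 17 / (32 * b)).
move: (Num.sqrt _) s2 s1 E => s s2 s1 E.
have {}s1 : 1 <= s by rewrite -s2 in u1; clear - u1 s1; nra.
have y0 : 7 / 2 <= (mu_bound 8 : R) ^+ 2 by rewrite E; clear - s1 b20; lra.
have p : 0 < mu_bound 8 :> R.
  by rewrite lt_def sqrtr_ge0 andbT; apply: contraTneq y0 => ->;
    rewrite expr0n /= -ltNge; clear; lra.
move: (mu_bound 8) E y0 p => l E y0 p.
split=> [k /andP[k0]|].
  rewrite leq_eqVlt => /orP[/eqP->|k7]; first exact: cheb_8_gt0.
  apply: cheb_gt0 => //; last by rewrite k0.
  by clear - y0; lra.
apply/eqP; rewrite -subr_eq0; apply/eqP.
transitivity (- (4 * (l ^+ 2) ^+ 4 - 33 * (l ^+ 2) ^+ 3 + 85 * (l ^+ 2) ^+ 2 - 70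
  * l ^+ 2 + 9)).
  by clear; rewrite /=; ring.
have alE : al = (3 * b ^+ 2 - 547) / 32 by rewrite b2; clear; field.
rewrite alE in s2 a3; rewrite E.
have b0 : b != 0 by rewrite gt_eqF //; clear - b20; lra.
(* Ferrari's method: in the quartic at l^2 = A + s / 2 the part odd in s vanishes identically by the
   choice of s^2, and the even part reduces to the resolvent cubic, which is zero by [a3]. *)
pose A := 33 / 16 + b / 16.
transitivity (- ((4 * (A ^+ 4 + 6 * A ^+ 2 * (s ^+ 2 / 4) + (s ^+ 2 / 4) ^+ 2)
   - 33 * (A ^+ 3 + 3 * A * (s ^+ 2 / 4)) + 85 * (A ^+ 2 + s ^+ 2 / 4) - 70 * A + 9)
   + s / 2 * (4 * (4 * A ^+ 3 + 4 * A * (s ^+ 2 / 4)) - 33 * (3 * A ^+ 2 + s ^+ 2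
       / 4)
      + 85 * (2 * A) - 70))).
  by rewrite /A; clear; field.
rewrite s2 /A.
transitivity ((8 * ((3 * b ^+ 2 - 547) / 32) ^+ 3 - 4362 * ((3 * b ^+ 2 - 547) / 32)
   - (34 * 1000 + 607)) / (27 * b ^+ 2)).
  by clear - b0; field.
by rewrite a3 subrr mul0r.
Qed.

End Bounds.

(** * Perron vectors *)

Section Eigenvectors.
Variable R : realType.
Implicit Types (h l : R) (z : nat -> R).

Lemma sum_ord_delta n k z : (k < n)%N -> \sum_(j < n) (val j == k)%:R * z j = z k.
Proof.
move=> kn; rewrite (bigD1 (Ordinal kn)) //= eqxx mul1r big1 ?addr0 // => j.
by rewrite -val_eqE /= => /negPf ->; rewrite mul0r.
Qed.

Lemma sum_ord_delta0 n k z : (n <= k)%N -> \sum_(j < n) (val j == k)%:R * z j = 0.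
Proof.
move=> kn; rewrite big1 // => j _; rewrite ltn_eqF ?mul0r //.
exact: leq_trans (ltn_ord j) kn.
Qed.

(* Vectors are shifted by one, z k.+1 being the value at the vertex k. *)
Lemma cartanA_mul n h z (i : 'I_n) : z 0%N = 0 ->
  \sum_j cartanA n h i j * z j.+1 = h * z i.+1 - z i - (i.+1 < n)%:R * z i.+2.
Proof.
move=> z0.
transitivity (\sum_(j < n) (h * ((val j == i)%:R * z j.+1) -
   ((val j).+1 == i)%:R * z j.+1 - (val j == i.+1)%:R * z j.+1)).
  apply: eq_bigr => j _; rewrite !mxE /consecutive -val_eqE /=.
  rewrite [(_ == i :> nat) in RHS]eq_sym [(_.+1 == i) in RHS]eq_sym.
  move: (val i) (val j) => x y; case e1: (x == y); case e2: (y == x.+1);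
    case e3: (x == y.+1); rewrite /=; by [ring | exfalso; lia].
rewrite !sumrB -big_distrr /= (sum_ord_delta (fun j => z j.+1)) //;
  congr (_ - _ - _).
  case: i => -[|i] ip /=.
    by rewrite big1 ?z0 // => j _; rewrite mul0r.
  by under eq_bigr do rewrite eqSS; rewrite (sum_ord_delta (fun j => z j.+1)) //
    ltnW.
have [lt|le] := ltnP i.+1 n.
  by rewrite (sum_ord_delta (fun j => z j.+1)) // mul1r.
by rewrite (sum_ord_delta0 (fun j => z j.+1)) // mul0r.
Qed.

Lemma edge_mul n a b z (i : 'I_n) : (a < n)%N -> (b < n)%N -> a != b ->
  \sum_(j < n) (edge a b i j)%:R * z j = (i == a :> nat)%:R * z b + (i == b :>
    nat)%:R * z a.
Proof.
move=> an bn ab; rewrite /edge.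
have [->|ia] := eqVneq (nat_of_ord i) a.
  rewrite (negPf ab) /= mul1r mul0r addr0.
  by under eq_bigr do rewrite orbF; exact: sum_ord_delta.
rewrite /= mul0r add0r; have [ib|ib] := eqVneq (nat_of_ord i) b.
  by rewrite mul1r; exact: sum_ord_delta.
by rewrite big1 ?mul0r // => j _; rewrite mul0r.
Qed.

(** D_n and E_n arise from the path by moving its last edge from vertex n - 2 to vertex b. Balanced
    sums of natural numbers express this without truncated subtraction. *)
Lemma cartanDE_adj b n x y : (b.+2 < n)%N -> (x < n)%N -> (y < n)%N ->
  let c := (y == x.+1) || (x == y.+1) in
  let e a := ((x == a) && (y == n.-1)) || ((x == n.-1) && (y == a)) in
  if x == y then ~~ e b && ~~ e n.-2
  else (([&& c, x < n.-1 & y < n.-1] || e b) + e n.-2 == c + e b)%N.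
Proof. by case: n => [|[|n]] //= bn xn yn; case: eqP; lia. Qed.

Lemma cartanDE_entry n b h (i j : 'I_n) : (b.+2 < n)%N ->
  (if i == j then h
   else if [&& consecutive i j, i < n.-1 & j < n.-1]%N || edge b n.-1 i j then -1
     else 0)
  = cartanA n h i j + (edge n.-2 n.-1 i j)%:R - (edge b n.-1 i j)%:R.
Proof.
move=> bn; rewrite mxE -val_eqE /=.
have := cartanDE_adj bn (ltn_ord i) (ltn_ord j) => /=.
rewrite -/(edge b n.-1 i j) -/(edge n.-2 n.-1 i j) -/(consecutive i j).
case: eqP => _; first by move=> /andP[/negPf -> /negPf ->] /=; ring.
move/eqP/(congr1 (fun k : nat => k%:R : R)); rewrite !natrD => E.
transitivity (- ([&& consecutive i j, i < n.-1 & j < n.-1]%N || edge b n.-1 i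
  j)%:R : R).
  by case: (_ || _); rewrite ?oppr0.
transitivity (- (consecutive i j)%:R + (edge n.-2 n.-1 i j)%:R - (edge b n.-1 i
  j)%:R : R).
  by move: E; move: (_%:R) (_%:R) (_%:R) (_%:R) => x y z t; lra.
by case: (consecutive i j); rewrite ?oppr0.
Qed.

Lemma cartanDE_mul n b h (M : 'M[R]_n) z (i : 'I_n) : (b.+2 < n)%N -> z 0%N = 0 ->
  (forall j, M i j = if i == j then h
   else if [&& consecutive i j, i < n.-1 & j < n.-1]%N || edge b n.-1 i j then -1
     else 0) ->
  \sum_j M i j * z j.+1 = h * z i.+1 - z i - (i.+1 < n)%:R * z i.+2
    + (i.+2 == n)%:R * z n - (i == b :> nat)%:R * z n
    + (i.+1 == n)%:R * (z n.-1 - z b.+1).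
Proof.
move=> bn z0 ME.
under eq_bigr do rewrite ME cartanDE_entry // mulrBl mulrDl.
rewrite sumrB big_split /= cartanA_mul //.
have n1 : (n.-1 < n)%N by lia.
have n2 : (n.-2 < n)%N by lia.
have bn' : (b < n)%N by lia.
rewrite (edge_mul (fun j => z j.+1)) //; last by lia.
rewrite (edge_mul (fun j => z j.+1)) //; last by lia.
have -> : (i == n.-2 :> nat) = (i.+2 == n) by lia.
have -> : (i == n.-1 :> nat) = (i.+1 == n) by lia.
have -> : n.-2.+1 = n.-1 by lia.
have -> : n.-1.+1 = n by lia.
by ring.
Qed.

Lemma cartanB_mul n h z (i : 'I_n) : (1 < n)%N -> z 0%N = 0 ->
  \sum_j cartanB n h i j * z j.+1 =
  h * z i.+1 - z i - (i.+1 < n)%:R * z i.+2 - (i.+2 == n)%:R * z n.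
Proof.
move=> n1 z0; rewrite -cartanA_mul //.
have n1' : (n.-1 < n)%N by lia.
have <- : z n.-1.+1 = z n by congr z; lia.
rewrite -(sum_ord_delta (fun j => z j.+1) n1') big_distrr /= -sumrB.
apply: eq_bigr => j _; rewrite mxE.
have -> : (j.+1 == n) = (j == n.-1 :> nat) by lia.
case: eqP => [En|_] /=; last by ring.
case: eqP => [jn|_] /=; last by ring.
have ij : i != j by rewrite -val_eqE /=; lia.
have cij : consecutive i j by rewrite /consecutive; lia.
by rewrite mxE (negPf ij) cij; ring.
Qed.

(* The symmetrization of B_n has the single edge weight 3 / 2, at its end. *)
Lemma cartanB_sym_mul n h z (i : 'I_n) : (1 < n)%N -> z 0%N = 0 ->
  \sum_j (cartanB n h + (cartanB n h)^T) i j * z j.+1 =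
  2 * (h * z i.+1 - z i - (i.+1 < n)%:R * z i.+2)
    - (i.+2 == n)%:R * z n - (i.+1 == n)%:R * z n.-1.
Proof.
move=> n1 z0.
have n1' : (n.-1 < n)%N by lia.
have n2' : (n.-2 < n)%N by lia.
transitivity (2 * \sum_j cartanA n h i j * z j.+1 -
  \sum_(j < n) (edge n.-2 n.-1 i j)%:R * z j.+1).
  rewrite big_distrr -sumrB; apply: eq_bigr => j _ /=; rewrite !mxE [j == i]eq_sym.
  rewrite /edge [X in _ || X]andbC; have -> : consecutive j i = consecutive i j
    by rewrite /consecutive orbC.
  have -> : (i.+2 == n) = (i == n.-2 :> nat) by lia.
  have -> : (j.+2 == n) = (j == n.-2 :> nat) by lia.
  have -> : (i.+1 == n) = (i == n.-1 :> nat) by lia.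
  have -> : (j.+1 == n) = (j == n.-1 :> nat) by lia.
  have [/andP[/eqP Ei /eqP Ej]|e1] := boolP ((i == n.-2 :> nat) && (j == n.-1 :>
    nat)).
    have ij : i != j by rewrite -val_eqE /=; lia.
    have cij : consecutive i j by rewrite /consecutive; lia.
    have -> : (j == n.-2 :> nat) = false by lia.
    by rewrite (negPf ij) cij /=; ring.
  have [/andP[/eqP Ej /eqP Ei]|e2] := boolP ((j == n.-2 :> nat) && (i == n.-1 :>
    nat)).
    have ij : i != j by rewrite -val_eqE /=; lia.
    have cij : consecutive i j by rewrite /consecutive; lia.
    by rewrite (negPf ij) cij /=; ring.
  by rewrite /=; case: (i == j); case: (consecutive i j); ring.
rewrite cartanA_mul // (edge_mul (fun j => z j.+1)) //; last by lia.
have -> : (i == n.-2 :> nat) = (i.+2 == n) by lia.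
have -> : (i == n.-1 :> nat) = (i.+1 == n) by lia.
have -> : n.-2.+1 = n.-1 by lia.
have -> : n.-1.+1 = n by lia.
by ring.
Qed.

Lemma cartanF_mul h z (i : 'I_4) : z 0%N = 0 ->
  \sum_j cartanF 4 h i j * z j.+1 =
  h * z i.+1 - z i - (i.+1 < 4)%:R * z i.+2 - (i == 1%N :> nat)%:R * z 3.
Proof.
move=> z0; rewrite -cartanA_mul // -(sum_ord_delta (n := 4) (fun j => z j.+1) (k
  := 2)) //.
rewrite big_distrr /= -sumrB.
apply: eq_bigr => j _; rewrite mxE.
case: eqP => [E1|_] /=; last by ring.
case: eqP => [E2|_] /=; last by ring.
have ij : i != j by rewrite -val_eqE /=; lia.
have cij : consecutive i j by rewrite /consecutive; lia.
by rewrite mxE (negPf ij) cij; ring.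
Qed.

Definition perron n (M : 'M[R]_n) (c : R) :=
  exists2 y : 'I_n -> R, forall i, 0 < y i & forall i, \sum_j M i j * y j = c * y i.

(** The sequence sin (k x) obeys the three-term recurrence and vanishes at k = 0 and k = n + 1, so
    the recurrence holds at both ends of the path. *)
Lemma perron_A n h : (0 < n)%N -> perron (cartanA n h) (h - 2 * cos (pi / n.+1%:R)).
Proof.
move=> n0; set x := pi / _; have nz : n.+1%:R != 0 :> R by rewrite pnatr_eq0.
have p0 := pi_gt0 R; have N0 : 0 < n.+1%:R :> R by rewrite ltr0n.
have x0 : 0 < x by rewrite divr_gt0.
exists (fun i => sin (i.+1%:R * x)) => i.
  rewrite sin_gt0_pi // mulr_gt0 ?ltr0n //= /x mulrCA gtr_pMr //.
  by rewrite ltr_pdivrMr // mul1r ltr_nat ltnS ltn_ord.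
rewrite (@cartanA_mul _ _ (fun k => sin (k%:R * x))) ?mul0r ?sin0 //.
have -> : (i.+1 < n)%:R * sin (i.+2%:R * x) = sin (i.+2%:R * x).
  case: ltnP => [|ni]; first by rewrite mul1r.
  have -> : i.+2 = n.+1 by have := ltn_ord i; lia.
  by rewrite mul0r /x mulrC divfK // sinpi.
by rewrite mulrBl -sin_consecutive; ring.
Qed.

Lemma sin_quarter (m : nat) (x : R) : m.+1%:R * x = pi / 2 -> sin (m%:R * x) =
  cos x.
Proof.
rewrite -[m.+1]addn1 natrD mulrDl mul1r => E.
have -> : m%:R * x = pi / 2 - x by rewrite -E; ring.
by rewrite sinB sin_pihalf cos_pihalf; ring.
Qed.

Lemma sin_below_quarter (m k : nat) (x : R) : (0 < k <= m)%N -> m%:R * x = pi / 2 ->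
  0 < sin (k%:R * x).
Proof.
move=> /andP[k0 km] E; have p0 := pi_gt0 R.
have m0 : 0 < m%:R :> R by rewrite ltr0n; exact: leq_trans km.
have x0 : 0 < x by rewrite -(pmulr_rgt0 _ m0) E; lra.
have kx : k%:R * x <= pi / 2 by rewrite -E ler_pM2r // ler_nat.
by apply: sin_gt0_pi; rewrite mulr_gt0 ?ltr0n //=; lra.
Qed.

(** The last value is half of sin (n x) = 1: the doubled entry restores the sine in the row before,
    and the last row is sin ((n - 1) x) = cos x. This is the vector of D_(n+1) with its two fork
    vertices identified. *)
Lemma perron_B n h : (1 < n)%N -> perron (cartanB n h) (h - 2 * cos (pi / (2 *
  n%:R))).
Proof.
move=> n1; set x := pi / _.
have nx : n%:R * x = pi / 2 by rewrite /x; field; rewrite pnatr_eq0; lia.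
pose z k := if k == n then 1 / 2 else sin (k%:R * x) : R.
have zn : z n = 1 / 2 by rewrite /z eqxx.
have zk k : k != n -> z k = sin (k%:R * x) by rewrite /z => /negPf ->.
have z0 : z 0%N = 0 by rewrite zk ?mul0r ?sin0 //; lia.
exists (fun i => z i.+1) => i.
  have ip := ltn_ord i; rewrite /z; case: eqP => [_|_]; first by lra.
  by apply: (@sin_below_quarter n).
rewrite cartanB_mul //; have ip := ltn_ord i.
rewrite mulrBl; have [lt|le] := ltnP i.+2 n.
  have -> : (i.+1 < n)%N by lia.
  have -> : (i.+2 == n) = false by lia.
  rewrite zn !zk; try lia.
  by rewrite -sin_consecutive /=; ring.
have [E|E] := eqVneq i.+2 n.
  have -> : (i.+1 < n)%N by lia.
  rewrite E zn !zk; try lia.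
  by have := sin_consecutive x i; rewrite E nx sin_pihalf => <- /=; field.
have E1 : i.+1 = n by lia.
rewrite E1 ltnn zn zk; last by lia.
rewrite sin_quarter; first by rewrite /=; field.
by rewrite E1.
Qed.

(** The two fork vertices share the value sin ((n - 1) x) = 1 equally, so the sine recurrence
    persists at the branch vertex. *)
Lemma perron_D n h : (3 < n)%N ->
  perron (cartanD n h) (h - 2 * cos (pi / (2 * n.-1%:R))).
Proof.
move=> n3; set x := pi / _.
have nx : n.-1%:R * x = pi / 2 by rewrite /x; field; rewrite pnatr_eq0; lia.
pose z k := if (k < n.-1)%N then sin (k%:R * x) else 1 / 2 : R.
have zs k : (k < n.-1)%N -> z k = sin (k%:R * x) by rewrite /z => ->.
have zh k : (n.-1 <= k)%N -> z k = 1 / 2 by rewrite /z ltnNge => ->.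
have z0 : z 0%N = 0 by rewrite zs ?mul0r ?sin0 //; lia.
exists (fun i => z i.+1) => i.
  have ip := ltn_ord i; rewrite /z; case: ltnP => [k|_]; last by lra.
  by apply: (@sin_below_quarter n.-1); rewrite //= ltnW.
rewrite (@cartanDE_mul n (n - 3) h) //; last first.
- by move=> j; rewrite mxE subn1.
- by lia.
have ip := ltn_ord i; rewrite mulrBl.
have snq : sin (n.-2%:R * x) = cos x.
  by apply: sin_quarter; have -> : n.-2.+1 = n.-1 by lia.
have [lt|le] := ltnP i.+3 n.
  have -> : (i.+1 < n)%N by lia.
  have -> : (i.+2 == n) = false by lia.
  have -> : (i == (n - 3)%N :> nat) = false by lia.
  have -> : (i.+1 == n) = false by lia.
  rewrite (zh n) ?(zh n.-1) ?zs; try lia.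
  by rewrite -sin_consecutive /=; ring.
have [E|E] := eqVneq i.+3 n.
  have -> : (i.+1 < n)%N by lia.
  have -> : (i.+2 == n) = false by lia.
  have -> : (i == (n - 3)%N :> nat) by lia.
  have -> : (i.+1 == n) = false by lia.
  rewrite !(zh n) ?(zh i.+2) ?(zs i.+1) ?(zs i); try lia.
  have := sin_consecutive x i; have -> : i.+2 = n.-1 by lia.
  by rewrite nx sin_pihalf => <- /=; field.
have [E2|E2] := eqVneq i.+2 n.
  have -> : (i.+1 < n)%N by lia.
  have -> : (i == (n - 3)%N :> nat) = false by lia.
  have -> : (i.+1 == n) = false by lia.
  rewrite (zh n) ?(zh i.+2) ?(zh i.+1) ?(zs i); try lia.
  have -> : nat_of_ord i = n.-2 by lia.
  by rewrite snq /=; field.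
have E1 : i.+1 = n by lia.
have -> : (i == (n - 3)%N :> nat) = false by lia.
rewrite E1 eqxx ltnn !(zh n) ?(zh i) ?(zh n.-1) ?(zs (n - 3).+1); try lia.
have -> : (n - 3).+1 = n.-2 by lia.
by rewrite snq /=; field.
Qed.

(** The vector is found by solving the rows from the ends of the arms inwards and clearing
    denominators. All rows then hold identically except that of the branch vertex, which is the
    polynomial equation of [two_cos_pi12]. E_7 and E_8 are treated alike. *)
Lemma perron_E6 h : perron (cartanE 6 h) (h - 2 * cos (pi / 12)).
Proof.
have [l0 l2 lP] := two_cos_pi12 R; move: (2 * cos _) l0 l2 lP => l l0 l2 lP.
pose z k := nth 0 [:: 0; l; l ^+ 2; l * (l ^+ 2 - 1); l ^+ 2; l; l ^+ 2 - 1] k.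
have d0 : 0 < l ^+ 2 - 1 by lra.
exists (fun i => z i.+1).
  by case=> -[|[|[|[|[|[|i]]]]]] //= _; rewrite ?mulr_gt0 ?exprn_gt0.
move=> i; rewrite (@cartanDE_mul 6 2 h) //; last by move=> j; rewrite mxE.
case: i => -[|[|[|[|[|[|i]]]]]] //= _; rewrite /z /=; try ring.
apply/eqP; rewrite -subr_eq0; apply/eqP.
by transitivity (l ^+ 4 - 4 * l ^+ 2 + 1); [ring | exact: lP].
Qed.

Lemma perron_E7 h : perron (cartanE 7 h) (h - 2 * cos (pi / 18)).
Proof.
have [l0 l2 lP] := two_cos_pi18 R; move: (2 * cos _) l0 l2 lP => l l0 l2 lP.
pose d := l ^+ 2 - 1; pose c := l * (l ^+ 2 - 2).
have d0 : 0 < d by rewrite /d; lra.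
have c0 : 0 < c by rewrite mulr_gt0 //; lra.
have e0 : 0 < l ^+ 2 - 2 by lra.
pose z k := nth 0 [:: 0; c; l * c; c * d; d ^+ 2; l * d; d; (l ^+ 2 - 2) * d] k.
exists (fun i => z i.+1).
  by case=> -[|[|[|[|[|[|[|i]]]]]]] //= _; rewrite ?mulr_gt0 ?exprn_gt0.
move=> i; rewrite (@cartanDE_mul 7 2 h) //; last by move=> j; rewrite mxE.
case: i => -[|[|[|[|[|[|[|i]]]]]]] //= _; rewrite /z /c /d /=; try ring.
apply/eqP; rewrite -subr_eq0; apply/eqP.
by transitivity (l ^+ 6 - 6 * l ^+ 4 + 9 * l ^+ 2 - 3); [ring | exact: lP].
Qed.

Lemma perron_E8 h : perron (cartanE 8 h) (h - 2 * cos (pi / 30)).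
Proof.
have [l0 l2 lP] := two_cos_pi30 R; move: (2 * cos _) l0 l2 lP => l l0 l2 lP.
pose d := l ^+ 2 - 1; pose c := l ^+ 2 * (l ^+ 2 - 3) + 1.
have d0 : 0 < d by rewrite /d; lra.
have e0 : 0 < l ^+ 2 - 2 by lra.
have c0 : 0 < c by rewrite /c addr_gt0 // mulr_gt0 ?exprn_gt0 //; lra.
pose z k := nth 0 [:: 0; l * c; l ^+ 2 * c; l * d * c; l ^+ 2 * (l ^+ 2 - 2) * d;
  l * d ^+ 2; l ^+ 2 * d; l * d; d * c] k.
exists (fun i => z i.+1).
  by case=> -[|[|[|[|[|[|[|[|i]]]]]]]] //= _; rewrite ?mulr_gt0 ?exprn_gt0.
move=> i; rewrite (@cartanDE_mul 8 2 h) //; last by move=> j; rewrite mxE.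
case: i => -[|[|[|[|[|[|[|[|i]]]]]]]] //= _; rewrite /z /c /d /=; try ring.
apply/eqP; rewrite -subr_eq0; apply/eqP.
by transitivity (l ^+ 8 - 7 * l ^+ 6 + 14 * l ^+ 4 - 8 * l ^+ 2 + 1);
  [ring | exact: lP].
Qed.

(** This is the vector of E_6 with its two arms of length 2 folded together, hence the same
    eigenvalue. *)
Lemma perron_F h : perron (cartanF 4 h) (h - 2 * cos (pi / 12)).
Proof.
have [l0 l2 lP] := two_cos_pi12 R; move: (2 * cos _) l0 l2 lP => l l0 l2 lP.
have d0 : 0 < l ^+ 2 - 1 by lra.
pose z k := nth 0 [:: 0; l ^+ 2 - 1; l * (l ^+ 2 - 1); l ^+ 2; l] k.
exists (fun i => z i.+1).
  by case=> -[|[|[|[|i]]]] //= _; rewrite ?mulr_gt0 ?exprn_gt0.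
move=> i; rewrite cartanF_mul //.
case: i => -[|[|[|[|i]]]] //= _; rewrite /z /=; try ring.
apply/eqP; rewrite -subr_eq0; apply/eqP.
by transitivity (l ^+ 4 - 4 * l ^+ 2 + 1); [ring | exact: lP].
Qed.

(** Folding of D_4: 1 on the three identified leaves and 2 cos (pi / 6) = sqrt 3 at the centre. *)
Lemma perron_G h : perron (cartanG 2 h) (h - 2 * cos (pi / 6)).
Proof.
have c0 := cos_pi6_gt0 R; have c2 := cos_pi6_sq R.
move: (cos _) c0 c2 => c c0 c2.
exists (fun i => if i == ord0 then 1 else 2 * c).
  by move=> i; case: ifP => _ //; rewrite mulr_gt0.
move=> i; rewrite !big_ord_recl big_ord0 /= !mxE addr0.
case: i => -[|[|i]] //= _; first by ring.
apply/eqP; rewrite -subr_eq0; apply/eqP.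
by transitivity (4 * c ^+ 2 - 3); [ring | rewrite c2; field].
Qed.

Lemma perron_B_sym n h : (2 <= n <= 8)%N ->
  perron (cartanB n h + (cartanB n h)^T) (2 * (h - mu_bound n)).
Proof.
move=> /andP[n2 n8].
have [zp zr] : mu_spec n (mu_bound n : R).
  move: n n2 n8 => [|[|[|[|[|[|[|[|[|n]]]]]]]]] // _ _.
  - exact: mu_spec2. - exact: mu_spec3. - exact: mu_spec4. - exact: mu_spec5.
  - exact: mu_spec6. - exact: mu_spec7. - exact: mu_spec8.
move: (mu_bound n) zp zr => l zp zr.
pose z k := if k == n then 2 / 3 * cheb l k else cheb l k.
have zn : z n = 2 / 3 * cheb l n by rewrite /z eqxx.
have zk k : k != n -> z k = cheb l k by rewrite /z => /negPf ->.
have z0 : z 0%N = 0 by rewrite zk //; lia.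
exists (fun i => z i.+1) => i; have ip := ltn_ord i.
  have zi := zp i.+1 ip; rewrite /z; case: eqP => // _.
  by rewrite mulr_gt0.
rewrite cartanB_sym_mul //; have [lt|le] := ltnP i.+2 n.
  have -> : (i.+1 < n)%N by lia.
  have -> : (i.+2 == n) = false by lia.
  have -> : (i.+1 == n) = false by lia.
  rewrite !(zk i, zk i.+1, zk i.+2); try lia.
  by rewrite chebSS /=; ring.
have [E|E] := eqVneq i.+2 n.
  have -> : (i.+1 == n) = false by lia.
  have -> : (i.+1 < n)%N by lia.
  rewrite E zn (zk i) ?(zk i.+1); try lia.
  have -> : cheb l n = l * cheb l i.+1 - cheb l i.
    by rewrite -chebSS; congr cheb; exact: esym E.
  by rewrite /=; field.
have E1 : i.+1 = n by lia.
rewrite E1 eqxx ltnn zn (zk i) ?(zk n.-1); try lia.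
apply/eqP; rewrite -subr_eq0; apply/eqP.
have -> : nat_of_ord i = n.-1 by lia.
transitivity (- (9 * cheb l n.-1 - 4 * l * cheb l n) / 3);
  last by rewrite zr subrr oppr0 mul0r.
by rewrite /=; field.
Qed.

End Eigenvectors.

(** * Positivity criteria from Perron vectors *)

Section PerronCriteria.
Variable R : realType.

Definition subperron n (M : 'M[R]_n) (c : R) :=
  exists2 y : 'I_n -> R, forall i, 0 < y i & forall i, \sum_j M i j * y j <= c *
    y i.

(** At l = 2 the Chebyshev values are cheb 2 k = k, whence the vector. Its last row requires 9 (n -
    1) >= 8 n, so n = 9 is exactly where the symmetrized B_n reaches the eigenvalue 2. *)
Lemma subperron_B_sym n (h : R) : (9 <= n)%N ->
  subperron (cartanB n h + (cartanB n h)^T) (2 * (h - 2)).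
Proof.
move=> n9; have n9R : 9 <= n%:R :> R by rewrite ler_nat.
pose z k := if k == n then 2 / 3 * n%:R else k%:R : R.
have zn : z n = 2 / 3 * n%:R by rewrite /z eqxx.
have zk k : k != n -> z k = k%:R by rewrite /z => /negPf ->.
exists (fun i => z i.+1) => i; have ip := ltn_ord i.
  rewrite /z; case: eqP => _; last by rewrite ltr0n.
  by rewrite mulr_gt0 // ltr0n; lia.
rewrite cartanB_sym_mul //; [|by lia|by rewrite zk //; lia].
have [lt|le] := ltnP i.+2 n.
  have -> : (i.+1 < n)%N by lia.
  have -> : (i.+2 == n) = false by lia.
  have -> : (i.+1 == n) = false by lia.
  rewrite !(zk i, zk i.+1, zk i.+2); try lia.
  by rewrite -[i.+2]addn2 -[i.+1]addn1 !natrD /=; lra.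
have [E|E] := eqVneq i.+2 n.
  have -> : (i.+1 == n) = false by lia.
  have -> : (i.+1 < n)%N by lia.
  rewrite E zn (zk i) ?(zk i.+1); try lia.
  have -> : n%:R = i%:R + 2 :> R by rewrite -natrD addn2; congr _%:R; exact: esym E.
  by rewrite -[i.+1]addn1 !natrD /=; lra.
have E1 : i.+1 = n by lia.
rewrite E1 eqxx ltnn zn (zk i) ?(zk n.-1); try lia.
have -> : nat_of_ord i = n.-1 by lia.
have -> : n.-1%:R = n%:R - 1 :> R by rewrite -[in RHS](prednK (leq_trans _ n9))
  // -natr1 addrK.
by move: n9R; move: (n%:R) => t n9R /=; lra.
Qed.

(** The middle edge of the symmetrized F_4 has weight 3 / 2, and (1, 2, 2, 1) is an eigenvector for
    the eigenvalue 2 exactly. *)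
Lemma subperron_F_sym (h : R) : subperron (cartanF 4 h + (cartanF 4 h)^T) (2 * (h
  - 2)).
Proof.
exists (fun i : 'I_4 => nth 0 [:: 1; 2; 2; 1] i).
  by case=> -[|[|[|[|i]]]].
move=> i; rewrite !big_ord_recl big_ord0 /= !mxE /=.
by case: i => -[|[|[|[|i]]]] //= _; lra.
Qed.

Lemma subperron_G_sym (h : R) : subperron (cartanG 2 h + (cartanG 2 h)^T) (2 * (h
  - 2)).
Proof.
exists (fun _ : 'I_2 => 1); first by move=> i; exact: ltr01.
move=> i; rewrite !big_ord_recl big_ord0 /= !mxE /=.
by case: i => -[|[|i]] //= _; lra.
Qed.

Lemma no_neg_subperron n (M : 'M[R]_n) c : (0 < n)%N -> no_neg M -> subperron M c
  -> 0 <= c.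
Proof.
move=> n0 nM [y y0 yM]; rewrite leNgt; apply/negP => cneg.
have := nM y (fun i => ltW (y0 i)) _ (Ordinal n0).
have H i : 0 < y i -> \sum_j M i j * y j < 0.
  by move=> yi; apply: le_lt_trans (yM i) _; rewrite pmulr_llt0.
by move=> /(_ H) E; have := y0 (Ordinal n0); rewrite E ltxx.
Qed.

Lemma no_neg_perron n (M : 'M[R]_n) c : (0 < n)%N -> no_neg M -> perron M c -> 0
  <= c.
Proof.
move=> n0 nM [y y0 yM]; apply: (no_neg_subperron n0 nM).
by exists y => // i; rewrite yM.
Qed.

Lemma perron_virtual_psd n (M : 'M[R]_n) c : (forall i j, i != j -> M i j <= 0) ->
  0 <= c -> perron M c -> virtual_psd M.
Proof.
move=> Moff c0 [y y0 yM]; apply: (superharmonic_virtual_psd Moff y0) => i.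
by rewrite yM mulr_ge0 // ltW.
Qed.

Lemma perron_psd n (M : 'M[R]_n) c : M^T = M -> (forall i j, i != j -> M i j <=
  0) ->
  0 <= c -> perron M c -> psd M.
Proof.
move=> MT Moff c0 [y y0 yM]; apply: (superharmonic_psd MT Moff y0) => i.
by rewrite yM mulr_ge0 // ltW.
Qed.

Lemma perron_sym_gpsd n (M : 'M[R]_n) c : (forall i j, i != j -> M i j <= 0) ->
  0 <= c -> perron (M + M^T) c -> generalized_psd M.
Proof.
move=> Moff c0 [y y0 yM]; apply: (superharmonic_gpsd Moff y0) => i.
by rewrite yM mulr_ge0 // ltW.
Qed.

End PerronCriteria.

(** * Application to Shuhan matrices *)

Section Permutation.
Variables (R : realType) (n : nat) (H : 'M[R]_n) (s : 'S_n).

Lemma mxconj_permE : mxconj_perm H s = mxsub s s H.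
Proof. by apply/matrixP => i j; rewrite !mxE. Qed.

Lemma mxconj_permK : mxsub (s^-1)%g (s^-1)%g (mxconj_perm H s) = H.
Proof. by apply/matrixP => i j; rewrite !mxE !permKV. Qed.

Lemma tr_mxconj_perm : (mxconj_perm H s)^T = mxconj_perm H^T s.
Proof. by apply/matrixP => i j; rewrite !mxE. Qed.

Lemma gpsd_mxconj_perm : generalized_psd (mxconj_perm H s) <-> generalized_psd H.
Proof.
split=> [g|g]; last by rewrite mxconj_permE; exact: gpsd_mxsub.
by rewrite -mxconj_permK; exact: gpsd_mxsub.
Qed.

Lemma virtual_psd_mxconj_perm : virtual_psd (mxconj_perm H s) <-> virtual_psd H.
Proof.
split=> /virtual_psdP g; apply/virtual_psdP; last by rewrite mxconj_permE;
  exact: minors_ge0_mxsub.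
by rewrite -mxconj_permK; exact: minors_ge0_mxsub.
Qed.

Lemma psd_mxconj_perm : psd (mxconj_perm H s) <-> psd H.
Proof.
rewrite /psd; split=> -[HT /gpsd_mxconj_perm g]; split=> //.
  by rewrite -mxconj_permK trmx_mxsub HT.
by rewrite tr_mxconj_perm HT.
Qed.

End Permutation.

Lemma virtual_psd_tr (R : realType) n (M : 'M[R]_n) : virtual_psd M ->
  virtual_psd M^T.
Proof. by move=> /virtual_psdP g; apply/virtual_psdP; exact: minors_ge0_tr. Qed.

Lemma indecomposable_connected (R : realType) n (H : 'M[R]_n) (S : {set 'I_n}) w u :
  indecomposable H -> (forall i j, H i j = 0 -> H j i = 0) ->
  w \in S -> u \notin S -> exists w' u', [/\ w' \in S, u' \notin S & H w' u' != 0].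
Proof.
move=> iH Hsym wS uS.
have [/existsP[w' /existsP[u' /and3P[]]]|] :=
  boolP [exists w', exists u', [&& w' \in S, u' \notin S & H w' u' != 0]].
  by move=> *; exists w', u'.
move=> none; exfalso; apply: iH.
have H0 i j : i \in S -> j \notin S -> H i j = 0 /\ H j i = 0.
  move=> iS jS; have E : H i j = 0.
    apply/eqP; apply: contraNT none => Hij.
    by apply/existsP; exists i; apply/existsP; exists j; rewrite iS jS.
  by split=> //; exact: Hsym.
(* Listing [S] before its complement turns the missing connection into a block diagonal form; the
   blocks are nonempty because of [w] and [u]. *)
pose q := enum S ++ enum (~: S)%SET.
have uq : uniq q.
  rewrite cat_uniq !enum_uniq /= andbT; apply/hasPn => z.
  by rewrite !mem_enum inE.
have szq : size q = n.
  by rewrite size_cat -!cardE cardsC card_ord.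
pose f (i : 'I_n) := nth w q i.
have fI : injective f.
  move=> i j /eqP; rewrite nth_uniq ?szq // => /eqP; exact: val_inj.
have S0 : (0 < #|S|)%N by apply/card_gt0P; exists w.
have C0 : (0 < #|~: S|%SET)%N by apply/card_gt0P; exists u; rewrite inE.
have fS (i : 'I_n) : (i < #|S|)%N -> f i \in S.
  by move=> iS; rewrite /f nth_cat -cardE iS -mem_enum mem_nth // -cardE.
have fC (i : 'I_n) : (#|S| <= i)%N -> f i \notin S.
  move=> iS; rewrite /f nth_cat -cardE ltnNge iS /=.
  have : nth w (enum (~: S)%SET) (i - #|S|) \in (~: S)%SET.
    rewrite -mem_enum mem_nth // -cardE ltn_subLR // cardsC card_ord.
    exact: ltn_ord.
  by rewrite inE.
have e : (#|S|.-1.+1 + #|~: S|%SET.-1.+1)%N = n.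
  by rewrite !prednK // cardsC card_ord.
pose M := castmx (esym e, esym e) (mxconj_perm H (perm fI)).
exists (perm fI), #|S|.-1, #|~: S|%SET.-1, e, (ulsubmx M), (drsubmx M).
have ur : ursubmx M = 0.
  apply/matrixP => i j; rewrite !mxE castmxE !mxE !permE.
  apply: (H0 _ _ (fS _ _) (fC _ _)).1 => /=.
    by apply: leq_trans (ltn_ord i) _; rewrite prednK.
  by rewrite prednK // leq_addr.
have dl : dlsubmx M = 0.
  apply/matrixP => i j; rewrite !mxE castmxE !mxE !permE.
  apply: (H0 _ _ (fS _ _) (fC _ _)).2 => /=.
    by apply: leq_trans (ltn_ord j) _; rewrite prednK.
  by rewrite prednK // leq_addr.
by rewrite -[in RHS]ur -[in RHS]dl submxK /M castmxKV.
Qed.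

Section Shuhan.
Variables (R : realType) (h : R) (n : nat) (H : 'M[R]_n).
Hypotheses (h2 : h < 2) (n0 : (0 < n)%N) (sH : shuhan h H) (iH : indecomposable H).

Lemma shuhan_diag i : H i i = h. Proof. by case: sH. Qed.

Lemma shuhan_off i j : i != j -> H i j <= 0.
Proof. by case: sH => _ _ /(_ i j) H1 _ /H1 []. Qed.

Definition shuhan_weight i j : nat := if i == j then 0 else Num.truncn (- H i j).

Lemma shuhan_weightE i j : i != j -> H i j = - (shuhan_weight i j)%:R.
Proof.
move=> ij; case: sH => _ _ /(_ i j ij) [Hint Hle] _.
rewrite /shuhan_weight (negPf ij) truncnK ?opprK //.
by rewrite natrEint rpredN Hint oppr_ge0.
Qed.

Lemma shuhan_weight_pair i j :
  [\/ shuhan_weight i j = shuhan_weight j i,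
      (1 < shuhan_weight i j)%N /\ shuhan_weight j i = 1%N
    | (1 < shuhan_weight j i)%N /\ shuhan_weight i j = 1%N].
Proof.
have [->|ij] := eqVneq i j; first by constructor 1.
have ji : j != i by rewrite eq_sym.
have := shuhan_weightE ij; have := shuhan_weightE ji.
case: sH => _ _ _ /(_ i j ij); move: (shuhan_weight i j) (shuhan_weight j i) => x
  y + Ey Ex.
rewrite Ex Ey => -[/oppr_inj/eqP|[+ /oppr_inj/eqP]|[+ /oppr_inj/eqP]].
- by rewrite eqr_nat => /eqP; constructor 1.
- by rewrite ltrN2 ltr_nat pnatr_eq1 => yx /eqP y1; constructor 2;
    rewrite y1 in yx *.
- by rewrite ltrN2 ltr_nat pnatr_eq1 => yx /eqP y1; constructor 3;
    rewrite y1 in yx *.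
Qed.

(** Here [h < 2] enters: row i of H x is h x_i minus the weighted sum, which is strictly less than 2
    x_i minus that sum when x_i > 0. *)
Lemma shuhan_weight_excl : no_neg H -> forall x : 'I_n -> nat,
  (forall i, (0 < x i)%N -> (2 * x i <= \sum_j shuhan_weight i j * x j)%N) ->
  forall i, x i = 0%N.
Proof.
move=> nH x xH i; apply/eqP; rewrite -(eqr_nat R); apply/eqP.
apply: (nH (fun i => (x i)%:R)) => {i} [i|i]; first exact: ler0n.
rewrite ltr0n => xi; rewrite (bigD1 i) //= shuhan_diag.
have -> : \sum_(j | j != i) H i j * (x j)%:R = - (\sum_j shuhan_weight i j * x
  j)%:R.
  rewrite [in RHS](bigD1 i) //= {1}/shuhan_weight eqxx mul0n add0n natr_sum -sumrN.
  by apply: eq_bigr => j ji; rewrite shuhan_weightE 1?eq_sym // natrM mulNr.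
rewrite subr_lt0; apply: (@lt_le_trans _ _ (2 * (x i)%:R)).
  by rewrite ltr_pM2r // ltr0n.
by rewrite -natrM ler_nat xH.
Qed.

Lemma shuhan_weight_conn (S : {set 'I_n}) (w u : 'I_n) : w \in S -> u \notin S ->
  exists w' u', [/\ w' \in S, u' \notin S & (0 < shuhan_weight w' u')%N].
Proof.
move=> wS uS; have [i j|w' [u' [w'S u'S Hwu]]] := @indecomposable_connected R n H
  S w u iH _ wS uS.
  have [->//|ij] := eqVneq i j; have ji : j != i by rewrite eq_sym.
  rewrite !shuhan_weightE //; case: (shuhan_weight_pair i j) => [->//|[+ _]|[_ ->]].
    by case: (shuhan_weight i j) => // k _ /eqP; rewrite oppr_eq0 pnatr_eq0.
  by move/eqP; rewrite oppr_eq0 pnatr_eq0.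
have ne : w' != u' by apply: contraNneq u'S => <-.
exists w', u'; split=> //; rewrite lt0n; apply: contra Hwu => /eqP E.
by rewrite shuhan_weightE // E oppr0.
Qed.

Lemma shuhan_classification : no_neg H -> exists s : 'S_n, let Hs := mxconj_perm
  H s in
  (Hs = cartanA n h \/ (3 < n)%N /\ Hs = cartanD n h \/
   [\/ n = 6%N, n = 7%N | n = 8%N] /\ Hs = cartanE n h) \/
  ((1 < n)%N /\ is_B_up_to_transpose h Hs \/ n = 4%N /\ Hs = cartanF n h \/
   n = 2%N /\ Hs = cartanG n h).
Proof.
move=> nH; pose x0 := Ordinal n0.
have [|q [uq q_all]] := @finite_type_classification _ shuhan_weight _
  shuhan_weight_pair
  (shuhan_weight_excl nH) shuhan_weight_conn x0.
  by move=> i; rewrite /shuhan_weight eqxx.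
have szq : size q = n.
  by move/card_uniqP: uq => <-; rewrite -[RHS]card_ord; apply: eq_card => z;
    rewrite q_all.
rewrite szq; have sI : injective (fun i : 'I_n => nth x0 q i).
  by move=> i j /eqP; rewrite nth_uniq ?szq // => /eqP; exact: val_inj.
have entry b : agree n (fun k l => shuhan_weight (nth x0 q k) (nth x0 q l)) b ->
    forall i j : 'I_n, mxconj_perm H (perm sI) i j = if i == j then h else - (b i
      j)%:R.
  move=> Hb i j; rewrite mxE !permE; have [->|ij] := eqVneq i j;
    first exact: shuhan_diag.
  by rewrite shuhan_weightE ?(inj_eq sI) // Hb.
move=> ft; exists (perm sI) => /=.
case: ft => [/entry E|n1 /entry E|n1 /entry E|n3 /entry E|n5 n8 /entry E
  |n4 /entry E|n2 /entry E].
- left; left; apply/matrixP => i j; rewrite E !mxE /consecutive /consec.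
  by case: (i == j) => //; case: (_ || _); rewrite /= ?oppr0.
- right; left; split=> //; left; apply/matrixP => i j;
    rewrite E !mxE /shapeB /consecutive /consec.
  have [->|_] := eqVneq i j.
    by case: andP => // -[/eqP E1 /eqP E2]; exfalso; lia.
  by case: (_ && _) => //; case: (_ || _); rewrite /= ?oppr0.
- right; left; split=> //; right; apply/matrixP => i j.
  rewrite mxE E !mxE /shapeB /consecutive /consec eq_sym.
  have [->|_] := eqVneq i j.
    by case: andP => // -[/eqP E1 /eqP E2]; exfalso; lia.
  by case: (_ && _) => //; case: (_ || _); rewrite /= ?oppr0.
- left; right; left; split=> //; apply/matrixP => i j;
    rewrite E !mxE /shapeDE /consec /edge subn1 -/(consecutive i j).
  by case: (i == j) => //; case: (_ || _); rewrite /= ?oppr0.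
- left; right; right; split.
    have : n = 6%N \/ n = 7%N \/ n = 8%N by lia.
    by case=> [|[]] ->; [constructor 1|constructor 2|constructor 3].
  apply/matrixP => i j; rewrite E !mxE /shapeDE /consec /edge subn1
    -/(consecutive i j).
  by case: (i == j) => //; case: (_ || _); rewrite /= ?oppr0.
- right; right; left; split=> //; apply/matrixP => i j;
    rewrite E !mxE /shapeF /consecutive /consec.
  have [->|_] := eqVneq i j.
    by case: andP => // -[/eqP E1 /eqP E2]; exfalso; lia.
  by case: (_ && _) => //; case: (_ || _); rewrite /= ?oppr0.
- right; right; right; split=> //; apply/matrixP => i j;
    rewrite E !mxE /shapeG -val_eqE.
  by case: (_ == _) => //; case: (_ == _); rewrite /= ?oppr0.
Qed.

End Shuhan.

Section Symmetry.
Variables (R : realType) (n : nat) (h : R).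

Lemma consecutiveC (i j : 'I_n) : consecutive i j = consecutive j i.
Proof. by rewrite /consecutive orbC. Qed.

Lemma edgeC a b (i j : 'I_n) : edge a b i j = edge a b j i.
Proof. by rewrite /edge orbC [(j == a :> nat) && _]andbC [(j == b :> nat) &&
  _]andbC. Qed.

Lemma cartanA_tr : (cartanA n h)^T = cartanA n h.
Proof. by apply/matrixP => i j; rewrite !mxE eq_sym consecutiveC. Qed.

Lemma cartanD_tr : (cartanD n h)^T = cartanD n h.
Proof.
apply/matrixP => i j; rewrite !mxE eq_sym consecutiveC edgeC.
by rewrite [((j < _) && _)%N]andbC.
Qed.

Lemma cartanE_tr : (cartanE n h)^T = cartanE n h.
Proof.
apply/matrixP => i j; rewrite !mxE eq_sym consecutiveC edgeC.
by rewrite [((j < _) && _)%N]andbC.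
Qed.

Lemma cartanB_not_sym : (1 < n)%N -> (cartanB n h)^T <> cartanB n h.
Proof.
move=> n1; have i1 : (n.-2 < n)%N by lia.
have j1 : (n.-1 < n)%N by lia.
move/matrixP => /(_ (Ordinal i1) (Ordinal j1));
  rewrite !mxE -!val_eqE /consecutive /=.
have -> : (n.-1.+2 == n) = false by lia.
have -> : (n.-2.+2 == n) by lia.
have -> : (n.-1.+1 == n) by lia.
have -> : (n.-1 == n.-2) = false by lia.
have -> : (n.-1 == n.-2.+1) by lia.
rewrite orbT /= => /eqP; rewrite eqr_opp => /eqP; lra.
Qed.

End Symmetry.

Lemma cartanF_not_sym (R : realType) (h : R) : (cartanF 4 h)^T <> cartanF 4 h.
Proof.
move/matrixP => /(_ (inord 1) (inord 2)); rewrite !mxE -!val_eqE /consecutive /=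
  !inordK //=.
lra.
Qed.

Lemma cartanG_not_sym (R : realType) (h : R) : (cartanG 2 h)^T <> cartanG 2 h.
Proof. by move/matrixP => /(_ ord0 ord_max); rewrite !mxE /=; lra. Qed.

(** * The three equivalences *)

Section Classification.
Variables (R : realType) (h : R) (n : nat) (H : 'M[R]_n).
Hypotheses (h2 : h < 2) (n0 : (0 < n)%N) (sH : shuhan h H) (iH : indecomposable H).

Definition simply_laced_bound (Hs : 'M[R]_n) : Prop :=
  (Hs = cartanA n h /\ (0 < n)%N /\ 2 * cos (pi / n.+1%:R) <= h)
  \/ (Hs = cartanD n h /\ (3 < n)%N /\ 2 * cos (pi / (2 * n.-1%:R)) <= h)
  \/ (Hs = cartanE n h /\ n = 6%N /\ 2 * cos (pi / 12) <= h)
  \/ (Hs = cartanE n h /\ n = 7%N /\ 2 * cos (pi / 18) <= h)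
  \/ (Hs = cartanE n h /\ n = 8%N /\ 2 * cos (pi / 30) <= h).

Definition multiply_laced (Hs : 'M[R]_n) : Prop :=
  (1 < n)%N /\ is_B_up_to_transpose h Hs \/ n = 4%N /\ Hs = cartanF n h \/
  n = 2%N /\ Hs = cartanG n h.

Lemma mxconj_perm_off (s : 'S_n) i j : i != j -> mxconj_perm H s i j <= 0.
Proof. by move=> ij; rewrite mxE (shuhan_off sH) // (inj_eq perm_inj). Qed.

Lemma simply_laced_psd (s : 'S_n) : simply_laced_bound (mxconj_perm H s) -> psd H.
Proof.
move=> sl; apply/(psd_mxconj_perm H s); have off := @mxconj_perm_off s.
case: sl off => [[-> [_ le]]|[[-> [n3 le]]|[[-> [n6 le]]|[[-> [n7 le]]|[-> [n8
  le]]]]]] off.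
- by apply: perron_psd (cartanA_tr n h) off _ (perron_A h n0); rewrite subr_ge0.
- by apply: perron_psd (cartanD_tr n h) off _ (perron_D h n3); rewrite subr_ge0.
- move: off; rewrite n6 => off.
  by apply: perron_psd (cartanE_tr 6 h) off _ (perron_E6 h); rewrite subr_ge0.
- move: off; rewrite n7 => off.
  by apply: perron_psd (cartanE_tr 7 h) off _ (perron_E7 h); rewrite subr_ge0.
- move: off; rewrite n8 => off.
  by apply: perron_psd (cartanE_tr 8 h) off _ (perron_E8 h); rewrite subr_ge0.
Qed.

(** [P] stands for virtual or generalized positivity. Only the simply laced types receive their
    bounds here: for the others the two notions lead to different eigenvalues, that of the Cartan
    matrix and that of its symmetrization. *)
Lemma no_neg_classification (P : forall m, 'M[R]_m -> Prop) :
  (forall m (M : 'M[R]_m), P m M -> no_neg M) ->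
  (forall s : 'S_n, P n H -> P n (mxconj_perm H s)) -> P n H ->
  (exists s : 'S_n, simply_laced_bound (mxconj_perm H s)) \/
  exists s : 'S_n, multiply_laced (mxconj_perm H s).
Proof.
move=> P_no_neg P_perm PH.
have [s /= [sl|ml]] := shuhan_classification h2 n0 sH iH (P_no_neg _ _ PH);
  last by right; exists s.
left; exists s; have := P_no_neg _ _ (P_perm s PH); rewrite /simply_laced_bound.
case: sl => [->|[[n3 ->]|[n678 ->]]] nn.
- by left; do 2!split=> //; rewrite -subr_ge0;
    exact: no_neg_perron nn (perron_A h n0).
- by right; left; do 2!split=> //; rewrite -subr_ge0;
    exact: no_neg_perron nn (perron_D h n3).
- do 2!right; case: n678 nn => -> nn.
  + by left; do 2!split=> //; rewrite -subr_ge0;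
      exact: no_neg_perron nn (perron_E6 h).
  + by right; left; do 2!split=> //; rewrite -subr_ge0;
      exact: no_neg_perron nn (perron_E7 h).
  + by right; right; do 2!split=> //; rewrite -subr_ge0;
      exact: no_neg_perron nn (perron_E8 h).
Qed.

Lemma multiply_laced_not_sym (s : 'S_n) : H^T = H -> ~ multiply_laced
  (mxconj_perm H s).
Proof.
move=> HT; have : (mxconj_perm H s)^T = mxconj_perm H s by rewrite tr_mxconj_perm
  HT.
move: (mxconj_perm H s) => M MT [[n1 [E|E]]|[[n4 E]|[n2 E]]].
- by apply: (@cartanB_not_sym R n h n1); rewrite -E.
- by apply: (@cartanB_not_sym R n h n1); rewrite -E trmxK.
- by move: M MT E; rewrite n4 => M MT E; apply: (@cartanF_not_sym R h); rewrite -E.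
- by move: M MT E; rewrite n2 => M MT E; apply: (@cartanG_not_sym R h); rewrite -E.
Qed.

Lemma psd_iff : psd H <-> exists s : 'S_n, simply_laced_bound (mxconj_perm H s).
Proof.
split=> [|[s]]; last exact: simply_laced_psd.
move=> [HT gH].
have [//|[s /(multiply_laced_not_sym HT)//]] := @no_neg_classification
  (fun m M => generalized_psd M) (fun m => @gpsd_no_neg R m)
  (fun s => (gpsd_mxconj_perm H s).2) gH.
Qed.

Lemma virtual_psd_iff : virtual_psd H <-> psd H \/ exists s : 'S_n,
  (is_B_up_to_transpose h (mxconj_perm H s) /\ (1 < n)%N /\ 2 * cos (pi / (2 *
    n%:R)) <= h)
  \/ (mxconj_perm H s = cartanF n h /\ n = 4%N /\ 2 * cos (pi / 12) <= h)
  \/ (mxconj_perm H s = cartanG n h /\ n = 2%N /\ 2 * cos (pi / 6) <= h).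
Proof.
split=> [vH|[[_ gH]|[s Hs]]].
- have [sl|[s ml]] := @no_neg_classification
    (fun m M => virtual_psd M) (fun m => @virtual_psd_no_neg R m)
    (fun s => (virtual_psd_mxconj_perm H s).2) vH.
    by left; apply/psd_iff.
  right; exists s; have := (virtual_psd_mxconj_perm H s).2 vH.
  case: ml => [[n1 B]|[[n4 ->]|[n2 ->]]] vHs.
  + left; split=> //; split=> //; rewrite -subr_ge0.
    have vB : virtual_psd (cartanB n h) by case: B => <- //; exact: virtual_psd_tr.
    exact: no_neg_perron (virtual_psd_no_neg vB) (perron_B h n1).
  + right; left; split=> //; split=> //; move: vHs; rewrite n4 -subr_ge0 => vHs.
    exact: no_neg_perron (virtual_psd_no_neg vHs) (perron_F h).
  + right; right; split=> //; split=> //; move: vHs; rewrite n2 -subr_ge0 => vHs.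
    exact: no_neg_perron (virtual_psd_no_neg vHs) (perron_G h).
- exact: gpsd_virtual_psd.
- apply/(virtual_psd_mxconj_perm H s); have off := @mxconj_perm_off s.
  have offT i j : i != j -> (mxconj_perm H s)^T i j <= 0.
    by move=> ij; rewrite mxE off // eq_sym.
  case: Hs off offT => [[[E|E] [n1 le]]|[[-> [n4 le]]|[-> [n2 le]]]] off offT.
  + by rewrite E in off *; apply: perron_virtual_psd off _ (perron_B h n1);
      rewrite subr_ge0.
  + rewrite -[mxconj_perm H s]trmxK; apply: virtual_psd_tr; rewrite E in offT *.
    by apply: perron_virtual_psd offT _ (perron_B h n1); rewrite subr_ge0.
  + move: off; rewrite n4 => off.
    by apply: perron_virtual_psd off _ (perron_F h); rewrite subr_ge0.
  + move: off; rewrite n2 => off.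
    by apply: perron_virtual_psd off _ (perron_G h); rewrite subr_ge0.
Qed.

Lemma is_B_sym (M : 'M[R]_n) : is_B_up_to_transpose h M ->
  M + M^T = cartanB n h + (cartanB n h)^T.
Proof. by case=> <- //; rewrite trmxK addrC. Qed.

Lemma generalized_psd_iff : generalized_psd H <-> psd H \/ exists s : 'S_n,
  is_B_up_to_transpose h (mxconj_perm H s) /\ (2 <= n <= 8)%N /\ mu_bound n <= h.
Proof.
split=> [gH|[[_ gH]|[s [B [n28 le]]]]].
- have [sl|[s ml]] := @no_neg_classification
    (fun m M => generalized_psd M) (fun m => @gpsd_no_neg R m)
    (fun s => (gpsd_mxconj_perm H s).2) gH.
    by left; apply/psd_iff.
  right; exists s.
  have hneg : 2 * (h - 2) < 0 by rewrite pmulr_rlt0 // subr_lt0.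
  (* The quadratic form sees only the symmetric part, so [no_neg] is used a second time, for the
     symmetrized matrix. Where its eigenvalue is at least 2, [hneg] refutes the case. *)
  have := gpsd_no_neg (gpsd_tr_add ((gpsd_mxconj_perm H s).2 gH)).
  case: ml => [[n1 B]|[[n4 ->]|[n2 ->]]].
  + rewrite (is_B_sym B) => nn; split=> //.
    have [n9|n8] := leqP 9 n.
      by have := no_neg_subperron n0 nn (subperron_B_sym h n9); rewrite leNgt hneg.
    have n28 : (2 <= n <= 8)%N by rewrite n1.
    split=> //; have := no_neg_perron n0 nn (perron_B_sym h n28).
    by rewrite pmulr_rge0 // subr_ge0.
  + rewrite n4 => nn.
    by have := @no_neg_subperron R 4 _ _ isT nn (subperron_F_sym h);
      rewrite leNgt hneg.
  + rewrite n2 => nn.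
    by have := @no_neg_subperron R 2 _ _ isT nn (subperron_G_sym h);
      rewrite leNgt hneg.
- exact: gH.
- apply/(gpsd_mxconj_perm H s).
  apply: (@perron_sym_gpsd R n _ (2 * (h - mu_bound n))).
  + exact: mxconj_perm_off.
  + by rewrite mulr_ge0 // subr_ge0.
  + by rewrite (is_B_sym B); exact: perron_B_sym.
Qed.

End Classification.

Theorem theorem3p9 (R : realType) (h : R) (n : nat) (H : 'M[R]_n) :
  0 <= h -> h < 2 -> (1 <= n)%N -> shuhan h H -> indecomposable H ->
  [/\ psd H <->
        (exists s : 'S_n, let Hs := mxconj_perm H s in
             (Hs = cartanA n h /\ (0 < n)%N /\ 2 * cos (pi / n.+1%:R) <= h)
          \/ (Hs = cartanD n h /\ (3 < n)%N /\
                2 * cos (pi / (2 * n.-1%:R)) <= h)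
          \/ (Hs = cartanE n h /\ n = 6%N /\ 2 * cos (pi / 12) <= h)
          \/ (Hs = cartanE n h /\ n = 7%N /\ 2 * cos (pi / 18) <= h)
          \/ (Hs = cartanE n h /\ n = 8%N /\ 2 * cos (pi / 30) <= h)),
      virtual_psd H <->
        (psd H \/
         exists s : 'S_n, let Hs := mxconj_perm H s in
             (is_B_up_to_transpose h Hs /\ (1 < n)%N /\
                2 * cos (pi / (2 * n%:R)) <= h)
          \/ (Hs = cartanF n h /\ n = 4%N /\ 2 * cos (pi / 12) <= h)
          \/ (Hs = cartanG n h /\ n = 2%N /\ 2 * cos (pi / 6) <= h))
    & generalized_psd H <->
        (psd H \/
         exists s : 'S_n, let Hs := mxconj_perm H s in
           is_B_up_to_transpose h Hs /\ (2 <= n <= 8)%N /\ mu_bound n <= h)].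
Proof.
move=> _ h2 n0 sH iH; split.
- exact: psd_iff h2 n0 sH iH.
- exact: virtual_psd_iff h2 n0 sH iH.
- exact: generalized_psd_iff h2 n0 sH iH.
Qed.
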